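(* Let $T$ be the block decomposition tree of some graph. Then for some integer $k\ge 0$, $T$ is (isomorphic to) the block decomposition tree of some graph in $\widehat{\mathcal{D}}_k$.
   Context: All graphs are undirected, simple, finite and non-empty. A graph $H$ is a minor of $G$ if a graph isomorphic to $H$ can be obtained from $G$ by a sequence of edge contractions, edge deletions and vertex deletions (after a contraction, parallel edges are replaced by a single edge). $\mathcal{D}_k$ is the class of graphs $G$ such that every minor of $G$ has minimum degree at most $k$. $\widehat{\mathcal{D}}_k$ is the set of minimal forbidden minors of $\mathcal{D}_k$: the graphs $G\notin\mathcal{D}_k$ such that every proper minor of $G$ is in $\mathcal{D}_k$. Let $G$ be a connected graph. Let $B$ be the set of blocks of $G$ (that is, cut-edges and maximal $2$-connected components) and let $C$ be the set of cut-vertices of $G$. The block decomposition tree of $G$ is the tree $T$ with $V(T)=B\cup C$, where $bc\in E(T)$ whenever the block $b\in B$ contains the cut-vertex $c\in C$. A block decomposition tree is a tree that is isomorphic to the block decomposition tree of some graph. *)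

(* Defs.v *)
From mathcomp Require Import all_boot.

Set Implicit Arguments.
Unset Strict Implicit.
Unset Printing Implicit Defensive.

Record sgraph := SGraph {
  vertex :> finType;
  edge : rel vertex;
  edge_sym : symmetric edge;
  edge_irrefl : irreflexive edge;
  vertex_nonempty : 0 < #|vertex|
}.

Definition rel_iso (V W : finType) (e : rel V) (f : rel W) : Prop :=
  exists2 h : V -> W, bijective h & forall x y, f (h x) (h y) = e x y.

Definition iso (G H : sgraph) : Prop := rel_iso (@edge G) (@edge H).

Section Operations.
Variables (V : finType) (e : rel V).

Definition del_edge (u v : V) : rel V :=
  [rel x y | e x y && ([set x; y] != [set u; v])].

Definition del_vertex (v : V) : rel {x : V | x != v} :=
  [rel x y | e (val x) (val y)].

(* The contraction of [u v] keeps the name [u] for the merged vertex; the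
   first conjunct discards the loop. *)
Definition contract (u v : V) : rel {x : V | x != v} :=
  [rel x y | (x != y) && [|| e (val x) (val y),
                             (val x == u) && e v (val y) |
                             (val y == u) && e (val x) v]].

Definition connected_in (S : {set V}) : bool :=
  [forall x in S, forall y in S,
     connect [rel a b | [&& a \in S, b \in S & e a b]] x y].

End Operations.

Inductive minor_step (G H : sgraph) : Prop :=
| StepDelEdge (u v : G) of edge u v & rel_iso (del_edge (@edge G) u v) (@edge H)
| StepDelVertex (v : G) of rel_iso (@del_vertex _ (@edge G) v) (@edge H)
| StepContract (u v : G) of edge u v & rel_iso (@contract _ (@edge G) u v) (@edge H).

(* [minor H G] : H is a minor of G. *)
Inductive minor (H G : sgraph) : Prop :=
| MinorIso of iso H G
| MinorStep (K : sgraph) of minor_step G K & minor H K.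

Definition proper_minor (H G : sgraph) : Prop := minor H G /\ ~ iso H G.

Definition degree (G : sgraph) (x : G) : nat := #|[set y | edge x y]|.

(* Every degree is below [#|G|] and G is non-empty, so the initial value
   [#|G|] never is the minimum. *)
Definition min_degree (G : sgraph) : nat :=
  \big[minn/#|G|]_(x : G) degree x.

Definition calD (k : nat) (G : sgraph) : Prop :=
  forall H : sgraph, minor H G -> min_degree H <= k.

Definition forbiddenD (k : nat) (G : sgraph) : Prop :=
  ~ calD k G /\ forall H : sgraph, proper_minor H G -> calD k H.

Section BlockTree.
Variable G : sgraph.

Definition connected : bool := connected_in (@edge G) [set: G].

Definition cut_vertex (v : G) : bool := ~~ connected_in (@edge G) [set~ v].

Definition cut_edge (u v : G) : bool :=
  edge u v && ~~ connected_in (del_edge (@edge G) u v) [set: G].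

Definition two_connected (S : {set G}) : bool :=
  [&& 2 < #|S|, connected_in (@edge G) S &
      [forall v in S, connected_in (@edge G) (S :\ v)]].

(* A block is represented by its vertex set: adding edges preserves
   2-connectedness, so a maximal 2-connected subgraph is induced. *)
Definition block (S : {set G}) : bool :=
  [exists u, exists v, cut_edge u v && (S == [set u; v])]
  || maxset two_connected S.

Definition block_tree_vertex : finType :=
  ({S : {set G} | block S} + {v : G | cut_vertex v})%type.

Definition block_tree_edge : rel block_tree_vertex := fun x y =>
  match x, y with
  | inl b, inr c => val c \in val b
  | inr c, inl b => val c \in val b
  | _, _ => false
  end.

End BlockTree.

(* For the one-vertex graph [block_tree_vertex] is empty, hence not the vertex
   set of any [sgraph]. [cut_vertex] and [cut_edge] have their usual meaning
   for connected graphs only. *)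
Definition is_block_tree (T G : sgraph) : Prop :=
  connected G /\ rel_iso (@edge T) (@block_tree_edge G).

(* Main.v *)
Require Import Defs.
From mathcomp Require Import all_boot zify.

(* Root the tree T at a block b0. For a large k every block b of the new graph
   consists of a core of k + 2 vertices (missing only a few matchings)
   together with the cut vertices of b. A cut vertex c is joined to k + 2 core
   vertices in all: to w(b) 2^|C| core vertices of each block b below c, and to
   the rest of them in the block above c. One matching edge is removed from a
   core for each cut vertex attached to it, so that every core vertex has degree
   exactly k + 1.

   Consider a minor of minimum degree at least k + 1, given by its branch sets.
   If some branch set lies inside the core of b, then counting the degree of a
   core vertex adjacent to all the vertices that are deleted, contracted or
   absorbed into branch sets of cut vertices shows that there are none: b is
   "full". A full block forces its cut vertices to be present. If a block is
   not full, choose one, b', of minimal depth. As the weight w(b') exceeds the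
   total weight of all deeper blocks, the branch set of the cut vertex above b'
   cannot make up for the degree lost in b'. Hence all blocks are full and the
   minor is the whole graph. *)

Set Implicit Arguments.
Unset Strict Implicit.
Unset Printing Implicit Defensive.

(** * Connectivity and nonseparable sets *)

Section Connectivity.
Variables (V : finType) (e : rel V).
Hypothesis e_sym : symmetric e.

(** Such predicates replace paths in most connectivity arguments: by [connected_inP] a set is
    connected exactly when each of them is constant on it. *)
Definition invariant_on (S : {set V}) (Q : pred V) :=
  {in S &, forall a b, e a b -> Q a = Q b}.

Definition restr (S : {set V}) := [rel a b | [&& a \in S, b \in S & e a b]].

Lemma restr_sym S : connect_sym (restr S).
Proof. by apply: sym_connect_sym => x y /=; rewrite e_sym andbCA. Qed.

Lemma connected_inP S :
  reflect (forall Q, invariant_on S Q -> {in S &, forall x y, Q x = Q y})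
          (connected_in e S).
Proof.
apply: (iffP forall_inP) => [conS Q invQ x y xS yS | conS x xS].
  have /forall_inP/(_ y yS) := conS x xS.
  have clQ : closed (restr S) Q.
    by move=> a b /and3P[aS bS ab]; apply: invQ.
  by apply: closed_connect.
apply/forall_inP => y yS.
rewrite -[_ y](conS (connect (restr S) x) _ x) ?connect0 // => a b aS bS ab.
by apply: (same_connect_r (@restr_sym S)); apply: connect1; apply/and3P.
Qed.

Lemma sub_invariant (S T : {set V}) Q :
  S \subset T -> invariant_on T Q -> invariant_on S Q.
Proof. by move=> /subsetP ST invQ a b aS bS; apply: invQ; apply: ST. Qed.

Lemma connected_sub_inv (S T : {set V}) Q :
    connected_in e S -> S \subset T -> invariant_on T Q ->
  {in S &, forall x y, Q x = Q y}.
Proof.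
by move=> /connected_inP conS ST invQ; apply: conS; apply: sub_invariant invQ.
Qed.

Lemma connected_hub (S : {set V}) z :
    (forall Q, invariant_on S Q -> {in S, forall x, Q x = Q z}) ->
  connected_in e S.
Proof.
by move=> hub; apply/connected_inP => Q invQ x y xS yS; rewrite !(hub Q invQ).
Qed.

Lemma connected_in1 v : connected_in e [set v].
Proof. by apply: (@connected_hub _ v) => Q _ x /set1P->. Qed.

Lemma connected_in2 u v : e u v -> connected_in e [set u; v].
Proof.
move=> uv; apply: (@connected_hub _ u) => Q invQ x xS.
by case/set2P: (xS) => -> //; apply: invQ; rewrite ?set21 ?set22 // e_sym.
Qed.

Lemma connected_path x p : path e x p -> connected_in e [set y in x :: p].
Proof.
move=> xp; apply: (@connected_hub _ x) => Q.
elim: p x xp => [|y p IHp] x /= => [_ _ z|/andP[xy yp] invQ z].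
  by rewrite !inE => /eqP->.
have Qxy : Q x = Q y by apply: invQ; rewrite // !inE eqxx ?orbT.
rewrite !inE => /predU1P[->|zp] //; rewrite Qxy; apply: IHp => //.
  by apply: sub_invariant invQ; apply/subsetP => t; rewrite !inE => ->; rewrite orbT.
by rewrite inE.
Qed.

(** The bound 1 in place of 2 admits single edges, so that cut-edges and maximal 2-connected
    subgraphs become maximal sets of one kind. *)
Definition nonseparable (S : {set V}) : bool :=
  [&& 1 < #|S|, connected_in e S & [forall v in S, connected_in e (S :\ v)]].

Lemma nonsepD1 S v : nonseparable S -> connected_in e (S :\ v).
Proof.
case/and3P=> _ conS /forall_inP conSD; have [/conSD //|vS] := boolP (v \in S).
by have ->: S :\ v = S by apply/setDidPl; rewrite disjoint_sym disjoints1.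
Qed.

Lemma nonsep_other S v : nonseparable S -> exists2 s, s \in S & s != v.
Proof.
case/and3P=> S_gt1 _ _; suff: 0 < #|S :\ v|.
  by case/card_gt0P=> s; rewrite !inE => /andP[]; exists s.
by move: S_gt1; rewrite (cardsD1 v); case: (v \in S) => //= /ltnW.
Qed.

(** Deleting [v] from a simple path leaves at most two subpaths, and each of them still contains an
    end of the path. *)
Lemma path_delete s p v Q :
    path e s p -> uniq (s :: p) -> invariant_on ([set y in s :: p] :\ v) Q ->
  forall x, x \in s :: p -> x != v ->
    (s != v /\ Q x = Q s) \/ (last s p != v /\ Q x = Q (last s p)).
Proof.
elim: p s => [|y p IHp] s /=.
  by move=> _ _ _ x; rewrite inE => /eqP-> ->; left.
case/andP=> sy yp /andP[s_yp y_uniq] invQ x; rewrite in_cons => /predU1P[->|x_yp] xv.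
  by left.
have invQy : invariant_on ([set z in y :: p] :\ v) Q.
  by apply: sub_invariant invQ; apply: setSD; apply/subsetP => z; rewrite !inE => ->; rewrite orbT.
have [s_v|sv] := eqVneq s v.
  right; have vDyp z : z \in y :: p -> z != v.
    by move=> z_yp; apply: contraNneq s_yp => z_v; rewrite s_v -z_v.
  split; first exact/vDyp/mem_last.
  have /connected_inP/(_ Q) := connected_path yp; apply; rewrite ?in_set ?mem_last //.
  by apply: sub_invariant invQy; apply/subsetP => z zp; rewrite !inE in zp *; rewrite zp vDyp.
case: (IHp y yp y_uniq invQy x x_yp xv) => [[yv ->]|]; [left | by right].
by split=> //; rewrite (invQ s y) // !inE ?eqxx ?sv ?yv ?orbT.
Qed.

Lemma nonsep_edge u v : irreflexive e -> e u v -> nonseparable [set u; v].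
Proof.
move=> e_irr uv; have uDv : u != v by apply: contraTneq uv => ->; rewrite e_irr.
rewrite /nonseparable cards2 uDv connected_in2 //; apply/forall_inP => w.
case/set2P=> ->.
  have ->: [set u; v] :\ u = [set v]; last exact: connected_in1.
  by apply/setP=> x; rewrite !inE; have [->|] := eqVneq x u; rewrite //= (negPf uDv).
have ->: [set u; v] :\ v = [set u]; last exact: connected_in1.
by apply/setP=> x; rewrite !inE orbC; have [->|] := eqVneq x v; rewrite //= eq_sym (negPf uDv).
Qed.

(* The vertices of a simple path from [s] to [s'] are added to [S :|: S']:
   deleting a vertex of the path leaves each of the two remaining subpaths
   attached to [s] or to [s']. *)
Lemma nonsep_merge (S S' : {set V}) c s s' :
    nonseparable S -> nonseparable S' -> c \in S -> c \in S' ->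
    s \in S -> s' \in S' -> s != c ->
    connect (restr [set~ c]) s s' ->
  exists2 U, nonseparable U & S :|: S' \subset U.
Proof.
move=> nsS nsS' cS cS' sS s'S' sc /connectP[p0 p0P def_s'].
case/shortenP: p0P def_s' => p p_path p_uniq _ def_s' {p0}.
have cp : all (predC1 c) (s :: p).
  elim: p s p_path {p_uniq def_s' sS} sc => [|y p IHp] x /=; first by move=> _ ->.
  by case/andP=> /and3P[_ yc _] /IHp{}IHp ->; apply: IHp; rewrite !inE in yc.
have {}p_path : path e s p by apply: sub_path p_path => a b /and3P[].
pose P := [set y in s :: p]; pose U := S :|: S' :|: P.
have sP : s \in P by rewrite !inE eqxx.
have s'P : s' \in P by rewrite def_s' inE mem_last.
have P_c y : y \in P -> y != c by rewrite inE => /(allP cp).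
have s'c := P_c _ s'P.
exists U; last exact: subsetUl.
have DS v : S :\ v \subset U :\ v by rewrite setSD // /U -setUA subsetUl.
have DS' v : S' :\ v \subset U :\ v by rewrite setSD // /U (setUC S) -setUA subsetUl.
have conP : connected_in e P by apply: connected_path.
have conUD v : connected_in e (U :\ v).
  (* If [c] is deleted, the path still links the two remainders; otherwise [c] links them, and only
     the pieces of the path need care. *)
  have [vc|vc] := eqVneq v c.
    have DP : P \subset U :\ v.
      by apply/subsetP => y yP; rewrite in_setD1 vc P_c // in_setU yP orbT.
    apply: (@connected_hub _ s) => Q invQ x; rewrite in_setD1 => /andP[xv].
    have QS := connected_sub_inv (nonsepD1 v nsS) (DS v) invQ.
    have QS' := connected_sub_inv (nonsepD1 v nsS') (DS' v) invQ.
    have QP := connected_sub_inv conP DP invQ.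
    case/setUP=> [/setUP[xS|xS]|xP]; last exact: QP.
      by apply: QS; rewrite in_setD1 ?xv // vc sc.
    by rewrite -(QP s' s) //; apply: QS'; rewrite in_setD1 ?xv // vc s'c.
  apply: (@connected_hub _ c) => Q invQ x; rewrite in_setD1 => /andP[xv].
  have QS := connected_sub_inv (nonsepD1 v nsS) (DS v) invQ.
  have QS' := connected_sub_inv (nonsepD1 v nsS') (DS' v) invQ.
  have cD (A : {set V}) : c \in A -> c \in A :\ v by rewrite in_setD1 eq_sym vc.
  case/setUP=> [/setUP[xS|xS]|xP].
  - by apply: QS; rewrite ?cD // in_setD1 xv.
  - by apply: QS'; rewrite ?cD // in_setD1 xv.
  have invQP : invariant_on ([set y in s :: p] :\ v) Q.
    by apply: sub_invariant invQ; apply: setSD; apply: subsetUr.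
  rewrite inE in xP; case: (path_delete p_path p_uniq invQP xP xv) => -[sv ->].
    by apply: QS; rewrite ?cD // in_setD1 sv.
  by rewrite -def_s' in sv *; apply: QS'; rewrite ?cD // in_setD1 sv.
have [_ conS _] := and3P nsS; have [_ conS' _] := and3P nsS'.
apply/and3P; split; last by apply/forall_inP.
  have [S_gt1 _ _] := and3P nsS; apply: leq_trans S_gt1 _.
  by apply: subset_leq_card; rewrite /U -setUA subsetUl.
apply: (@connected_hub _ c) => Q invQ x; rewrite /U.
have subS : S \subset U by rewrite /U -setUA subsetUl.
have subS' : S' \subset U by rewrite /U (setUC S) -setUA subsetUl.
have subP : P \subset U by apply: subsetUr.
have QS := connected_sub_inv conS subS invQ.
have QS' := connected_sub_inv conS' subS' invQ.
have QP := connected_sub_inv conP subP invQ.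
by case/setUP=> [/setUP[/QS|/QS']|/QP-/(_ s sP)->]; [apply | apply | apply: QS].
Qed.
Lemma avoid_invariant c x : invariant_on [set~ c] (connect (restr [set~ c]) x).
Proof.
move=> a b aS bS ab; apply: (same_connect_r (@restr_sym _)).
by apply: connect1; apply/and3P.
Qed.

(** Otherwise reachability from [x] avoiding [c] would be invariant on the whole graph, although it
    holds at [x] and fails at [c]. *)
Lemma avoid_neighbor c x :
    connected_in e [set: V] -> x != c ->
  exists2 u, e u c & connect (restr [set~ c]) x u.
Proof.
move=> conV xc; pose Q := connect (restr [set~ c]) x.
have [/existsP[u /andP[]]|noQ] := boolP [exists u, e u c && Q u]; first by exists u.
have noQu u : e u c -> Q u = false.
  by move=> uc; apply: contraNF noQ => Qu; apply/existsP; exists u; rewrite uc.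
have Qc : Q c = false.
  apply: contraNF xc; rewrite /Q restr_sym => /connectP[p].
  by case: p => [_ -> //|y p] /= /andP[/andP[]]; rewrite !inE eqxx.
have invQ : invariant_on [set: V] Q.
  move=> a b _ _ ab; have [a_c|ac] := eqVneq a c.
    by rewrite a_c Qc noQu // e_sym -a_c.
  have [b_c|bc] := eqVneq b c; first by rewrite b_c Qc noQu // -b_c.
  by apply: avoid_invariant; rewrite ?inE.
have := connected_inP _ conV _ invQ x c (in_setT x) (in_setT c).
by rewrite Qc /Q connect0.
Qed.

Lemma connected_avoid (S : {set V}) c : connected_in e S -> c \notin S ->
  {in S &, forall x y, connect (restr [set~ c]) x y}.
Proof.
move=> conS cS x y xS yS; have sub : S \subset [set~ c].
  by apply/subsetP => z zS; rewrite !inE; apply: contraNneq cS => <-.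
by rewrite -(connected_sub_inv conS sub (@avoid_invariant c x) xS yS) connect0.
Qed.

End Connectivity.

(** * Blocks as maximal nonseparable sets *)

Section Blocks.
Variable G : sgraph.
Hypothesis conG : connected G.

Local Notation e := (@edge G).
Let e_sym : symmetric e := @edge_sym G.
Local Notation nonsep := (nonseparable e).

(** In a larger nonseparable set a third vertex [w] is joined to [v] without [u] and to [u] without
    [v], hence to both without the edge between them. *)
Lemma cut_edge_maxset u v : cut_edge u v -> maxset nonsep [set u; v].
Proof.
case/andP=> uv; set e' := del_edge e u v => cut.
have e'_sym : symmetric e' by move=> x y; rewrite /e' /del_edge /= edge_sym setUC.
apply/maxsetP; split=> [|S nsS sub]; first exact: nonsep_edge (@edge_irrefl G) uv.
apply/eqP; rewrite eq_sym eqEsubset sub; apply/subsetP => w wS.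
apply: contraR cut; rewrite !inE negb_or => /andP[wu wv].
have [uS vS] : u \in S /\ v \in S by split; apply: (subsetP sub); rewrite !inE eqxx ?orbT.
apply/(connected_inP e'_sym) => Q invQ.
have QD z t : z \in [set u; v] -> t \in S -> t != z -> w != z -> Q t = Q w.
  move=> z_uv tS tz wz.
  apply: (connected_inP e_sym _ (nonsepD1 z nsS)); last 2 first.
  - by rewrite in_setD1 tz.
  - by rewrite in_setD1 wz.
  move=> a b; rewrite !in_setD1 => /andP[az _] /andP[bz _] ab.
  apply: invQ; rewrite ?in_setT //; apply/andP; split=> //; apply: contraTneq z_uv => <-.
  by rewrite !inE negb_or !(eq_sym z) az.
have uDv : u != v by apply: contraTneq uv => ->; rewrite edge_irrefl.
have Quv : Q u = Q v.
  by rewrite (QD v u) ?(QD u v) ?set21 ?set22 // eq_sym.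
apply: (connected_inP e_sym _ conG) => a b aT bT ab.
have [/setP ab_uv|ab_uv] := eqVneq [set a; b] [set u; v]; last by apply: invQ => //; apply/andP.
have: a \in [set u; v] by rewrite -ab_uv set21.
have: b \in [set u; v] by rewrite -ab_uv set22.
by case/set2P=> -> /set2P[] ->.
Qed.

(** If another neighbour [x] of [u] were reachable from [v] avoiding [u], merging the two edges at
    [u] would contradict maximality. So this reachability is invariant once the edge is deleted, and
    it separates [v] from [u]. *)
Lemma maxset_cut_edge u v : edge u v -> maxset nonsep [set u; v] -> cut_edge u v.
Proof.
move=> uv /maxsetP[nsuv maxuv]; rewrite /cut_edge uv /=; apply/negP => con'.
set e' := del_edge e u v in con'.
have e'_sym : symmetric e' by move=> x y; rewrite /e' /del_edge /= edge_sym setUC.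
have uDv : u != v by apply: contraTneq uv => ->; rewrite edge_irrefl.
pose Q := connect (restr e [set~ u]) v.
have Qu : Q u = false.
  apply: contraNF uDv; rewrite /Q (restr_sym e_sym) => /connectP[p].
  by case: p => [_ -> //|y p] /= /andP[/andP[]]; rewrite !inE eqxx.
have [/existsP[x /and3P[xu xv Qx]]|noQ] := boolP [exists x, [&& e x u, x != v & Q x]].
  have nsux := nonsep_edge e_sym (@edge_irrefl G) xu.
  have [|U nsU sub] := nonsep_merge e_sym nsuv nsux (set21 u v) (set22 x u)
    (set22 u v) (set21 x u) _ Qx; first by rewrite eq_sym.
  have subU : [set u; v] \subset U by apply: subset_trans sub; apply: subsetUl.
  have: x \in U by apply: (subsetP sub); rewrite !inE eqxx orbT.
  rewrite (maxuv U) // !inE (negPf xv) orbF => /eqP x_u.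
  by rewrite x_u edge_irrefl in xu.
have noQx x : e x u -> x != v -> Q x = false.
  by move=> xu xv; apply: contraNF noQ => Qx; apply/existsP; exists x; rewrite xu xv.
have invQ : invariant_on e' [set: G] Q.
  move=> a b _ _ /= /andP[ab ab_uv].
  have [a_u|au] := eqVneq a u.
    rewrite a_u in ab ab_uv *; rewrite Qu noQx // 1?e_sym //.
    by apply: contraNneq ab_uv => ->.
  have [b_u|bu] := eqVneq b u.
    rewrite b_u in ab ab_uv *; rewrite Qu noQx //.
    by apply: contraNneq ab_uv => ->; rewrite setUC.
  by apply: avoid_invariant; rewrite ?inE.
have := connected_inP e'_sym _ con' _ invQ v u (in_setT v) (in_setT u).
by rewrite Qu /Q connect0.
Qed.

(** Only the size tells the two kinds of block apart: a maximal nonseparable set of two vertices is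
    a cut-edge, a larger one is 2-connected. *)
Lemma block_nonsep (S : {set G}) : block S = maxset nonsep S.
Proof.
have two_ns T : two_connected T -> nonsep T.
  by case/and3P=> T_gt2 conT conTD; apply/and3P; split=> //; apply: ltnW.
apply/orP/idP => [[/existsP[u /existsP[v /andP[uv /eqP->]]]|]|].
- exact: cut_edge_maxset.
- case/maxsetP=> S2 maxS; apply/maxsetP; split=> [|T /and3P[T_gt1 conT conTD] ST].
    exact: two_ns.
  apply: maxS => //; apply/and3P; split=> //.
  by case/and3P: S2 => S_gt2 _ _; apply: leq_trans S_gt2 (subset_leq_card ST).
case/maxsetP=> nsS maxS; have [S_gt1 conS conSD] := and3P nsS.
have [S_gt2|S_le2] := ltnP 2 #|S|.
  right; apply/maxsetP; split=> [|T T2 ST]; first by apply/and3P.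
  by apply: maxS ST; apply: two_ns.
left; have /eqP/cards2P[u [v [uDv S_uv]]] : #|S| = 2 by apply/eqP; rewrite eqn_leq S_le2.
have uv : edge u v.
  apply: contraT => uv.
  have invQ : invariant_on e S (pred1 u).
    move=> a b; rewrite S_uv => /set2P[] -> /set2P[] -> //=; first by rewrite (negPf uv).
    by rewrite e_sym (negPf uv).
  have := connected_inP e_sym _ conS _ invQ u v; rewrite S_uv set21 set22 /= eqxx.
  by move=> /(_ isT isT)/esym; rewrite eq_sym (negPf uDv).
apply/existsP; exists u; apply/existsP; exists v; rewrite S_uv eqxx andbT.
by apply: maxset_cut_edge; rewrite // -S_uv; apply/maxsetP.
Qed.

Lemma nonsep_block (S : {set G}) : nonsep S -> exists2 U, block U & S \subset U.
Proof.
move=> nsS; have [U maxU SU] := maxset_exists nsS.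
by exists U; rewrite // block_nonsep.
Qed.

Lemma edge_block (x y : G) : edge x y -> exists2 U, block U & (x \in U) && (y \in U).
Proof.
move=> xy; have [U blU sub] := nonsep_block (nonsep_edge e_sym (@edge_irrefl G) xy).
by exists U; rewrite // !(subsetP sub) ?set21 ?set22.
Qed.

(** By [nonsep_merge] both blocks lie in one nonseparable set, and both are maximal. This is what
    rules out cycles in the block tree. *)
Lemma block_eq (S S' : {set G}) c s s' :
    block S -> block S' -> c \in S -> c \in S' -> s \in S -> s' \in S' -> s != c ->
    connect (restr e [set~ c]) s s' ->
  S = S'.
Proof.
rewrite !block_nonsep => /maxsetP[nsS maxS] /maxsetP[nsS' maxS'] cS cS' sS s'S' sc ss'.
have [U nsU] := nonsep_merge e_sym nsS nsS' cS cS' sS s'S' sc ss'.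
by rewrite subUset => /andP[/(maxS U nsU)<- /(maxS' U nsU)<-].
Qed.

Lemma block_ns S : @block G S -> nonsep S.
Proof. by rewrite block_nonsep => /maxsetP[]. Qed.

Lemma cut_vertex_mem (S S' : {set G}) x :
  block S -> block S' -> x \in S -> x \in S' -> S != S' -> cut_vertex x.
Proof.
move=> blS blS' xS xS'; apply: contraNT => /negPn conx.
have [s sS sx] := nonsep_other x (block_ns blS).
have [s' s'S' s'x] := nonsep_other x (block_ns blS').
apply/eqP; apply: (block_eq blS blS' xS xS' sS s'S' sx).
by apply: (connected_avoid e_sym conx); rewrite ?inE ?eqxx.
Qed.

(** Two vertices separated by [c] give neighbours of [c] on different sides. The blocks of the two
    edges to [c] differ, because a block minus [c] is connected. *)
Lemma cut_vertex_blocks c : cut_vertex c ->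
  exists S S' : {set G}, [/\ block S, block S', c \in S, c \in S' & S != S'].
Proof.
move=> cut_c.
have [x [y [xc yc xy]]] : exists x y, [/\ x != c, y != c & ~~ connect (restr e [set~ c]) x y].
  case/forall_inPn: cut_c => x; rewrite !inE => xc /forall_inPn[y]; rewrite !inE => yc xy.
  by exists x, y.
have [u uc xu] := avoid_neighbor e_sym conG xc.
have [v vc yv] := avoid_neighbor e_sym conG yc.
have [S blS /andP[uS cS]] := edge_block uc.
have [S' blS' /andP[vS' cS']] := edge_block vc.
exists S, S'; split=> //; apply: contraNneq xy => SS'; rewrite -SS' in vS' *.
apply: connect_trans xu _; rewrite (restr_sym e_sym); apply: connect_trans yv _.
have conD := nonsepD1 c (block_ns blS).
apply: (connected_avoid e_sym conD); rewrite ?in_setD1 ?eqxx ?uS ?vS' ?andbT //.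
  by apply: contraTneq vc => ->; rewrite edge_irrefl.
by apply: contraTneq uc => ->; rewrite edge_irrefl.
Qed.

End Blocks.

(** * The block tree is a rooted tree *)

Section Distance.
Variables (V : finType) (e : rel V) (r : V).
Hypothesis e_sym : symmetric e.

Lemma distance_to_root : connected_in e [set: V] ->
  exists d : V -> nat,
    d r = 0 /\ forall x, x != r -> exists2 y, e x y & d x = (d y).+1.
Proof.
move=> conV.
pose P x n := [exists p : n.-tuple V, path e x p && (last x p == r)].
have PP x n p : path e x p -> last x p = r -> size p = n -> P x n.
  move=> xp lp /eqP sz; apply/existsP; exists (Tuple sz).
  by rewrite /= xp lp eqxx.
have exP x : exists n, P x n.
  have: connect e x r.
    suff -> : connect e x r = connect e r r by [].
    apply: (connected_inP e_sym _ conV (connect e ^~ r)) => // a b _ _ ab.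
    by apply: (same_connect (sym_connect_sym e_sym)); apply: connect1.
  by case/connectP => p xp lp; exists (size p); apply: PP xp _ _.
pose d x := ex_minn (exP x); exists d.
have dP x : P x (d x) by rewrite /d; case: ex_minnP.
have d_min x n : P x n -> d x <= n by rewrite /d; case: ex_minnP => m _; apply.
split=> [|x xr]; first by apply/eqP; rewrite -leqn0; apply/d_min/(PP _ _ [::]).
have /existsP[[[|y p] sz] /andP[/= xp /eqP lp]] := dP x.
  by rewrite -lp eqxx in xr.
case/andP: xp => xy yp; exists y => //; apply/eqP; rewrite eqn_leq; apply/andP; split.
  have /existsP[[q /= sz'] /andP[yq /eqP lq]] := dP y.
  by apply/d_min/(PP _ _ (y :: q)); rewrite /= ?xy // (eqP sz').
by rewrite -(eqP sz) /= ltnS; apply/d_min/(PP _ _ p).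
Qed.

End Distance.

Definition incidence_rel (B C : Type) (I : B -> C -> bool) : rel (B + C) :=
  fun x y => match x, y with
  | inl b, inr c => I b c
  | inr c, inl b => I b c
  | _, _ => false
  end.

Lemma incidence_sym (B C : Type) (I : B -> C -> bool) : symmetric (incidence_rel I).
Proof. by case=> x [] y. Qed.

(* [p] sends a block to the cut vertex above it in the tree rooted at [b0],
   [q] sends a cut vertex to the block above it, and [ord] is a depth function. *)
Record rooted_at (B C : finType) (I : B -> C -> bool) (b0 : B)
    (p : B -> option C) (q : C -> B) (ord : B -> nat) : Prop := RootedAt {
  root_top : forall b, (p b == None) = (b == b0);
  ord_parent : forall b c, p b = Some c -> ord (q c) < ord b;
  has_child : forall c, exists b, p b = Some c;
  incE : forall b c, I b c = (p b == Some c) || (q c == b)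
}.

(** The root distance orients the tree. By acyclicity at [c] only one block at [c] is nearer to the
    root than [c]; all others become its children. *)
Lemma rooted_tree (B C : finType) (I : B -> C -> bool) (b0 : B) :
    connected_in (incidence_rel I) [set: B + C] ->
    (forall c, exists b b', [/\ I b c, I b' c & b != b']) ->
    (forall c b b', I b c -> I b' c ->
      connect (restr (incidence_rel I) [set~ inr c]) (inl b) (inl b') -> b = b') ->
  exists p q ord, rooted_at I b0 p q ord.
Proof.
move=> conT two acyc; set t := incidence_rel I.
have t_sym : symmetric t := @incidence_sym _ _ I.
have [d [d0 d_par]] := distance_to_root (inl b0) t_sym conT.
(* After [x], a shortest way to the root meets only nodes nearer than [x], and so avoids [z]. *)
have up x z : x != z -> d x <= d z -> connect (restr t [set~ z]) x (inl b0).
  move: {2}(d x) (leqnn (d x)) => n; elim: n x => [|n IHn] x xn xz dxz.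
    have [-> //|/d_par[y _ dx]] := eqVneq x (inl b0).
    by rewrite dx in xn.
  have [-> //|/d_par[y xy dx]] := eqVneq x (inl b0).
  have yz : y != z by apply: contraTneq dxz => <-; rewrite dx ltnn.
  apply: connect_trans (IHn y _ yz _); try lia.
  by apply: connect1; rewrite /= !inE xz yz.
have meet c b b' : I b c -> I b' c -> connect (restr t [set~ inr c]) (inl b) (inl b0) ->
    d (inl b') <= d (inr c) -> b = b'.
  move=> bc b'c b_up b'_up; apply: acyc bc b'c (connect_trans b_up _).
  by rewrite (restr_sym t_sym); apply: up.
pose p b := [pick c | I b c && (d (inl b) == (d (inr c)).+1)].
(* The default is never reached, as [qP] shows. *)
pose q c := odflt b0 [pick b | I b c && (d (inr c) == (d (inl b)).+1)].
have qP c : I (q c) c /\ d (inr c) = (d (inl (q c))).+1.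
  rewrite /q; case: pickP => [b /andP[bc /eqP] //|noq].
  have [//|[b|//] bc dc] := d_par (inr c).
  by have := noq b; rewrite dc eqxx andbT => /negbT/negP[].
have pP b c : p b = Some c -> I b c /\ d (inl b) = (d (inr c)).+1.
  by rewrite /p; case: pickP => // c1 /andP[bc1 /eqP] dc1 [<-].
have rootE b : (p b == None) = (b == b0).
  rewrite /p; case: pickP => [c /andP[_ /eqP db]|nop] /=.
    by apply/esym/negbTE; apply: contra_eq_neq db => ->; rewrite d0.
  apply/esym; apply: contraT => bb0.
  have [|[//|c] bc dc] := d_par (inl b); first by apply: contraNneq bb0 => -[->].
  by have := nop c; rewrite dc eqxx andbT => /negbT/negP[].
have parentE b c : I b c -> q c != b -> p b = Some c.
  move=> bc qcb; have [qc dc] := qP c.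
  have d_lt : d (inr c) < d (inl b).
    rewrite ltnNge; apply: contraNN qcb => dbc; apply/eqP/esym.
    by apply: (meet c); rewrite ?dc ?up.
  case def_p: (p b) => [c1|]; last first.
    by move/eqP: def_p; rewrite rootE => /eqP b_b0; rewrite b_b0 d0 in d_lt.
  have [bc1 db] := pP _ _ def_p; congr Some; apply/eqP; apply: contraT => c1c.
  have [qc1 dc1] := qP c1.
  (* With a parent [c1] other than [c], the block [b] would reach the root through [c] without [c1]
     and so be the block above [c1]; yet it is farther from the root than [c1]. *)
  suff b_q : b = q c1 by rewrite -b_q in dc1; lia.
  apply: (meet c1) => //; last by rewrite dc1.
  have cc1 : inr c != inr c1 :> B + C by apply: contraNneq c1c => -[->].
  apply: (@connect_trans _ _ (inr c)); last by apply: up => //; lia.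
  by apply: connect1; rewrite /= !in_setC1 cc1 bc.
exists p, q, (d \o inl); split=> //= [b c /pP[_ ->]|c|b c].
- by have [_ ->] := qP c; rewrite ltnS leqnSn.
- have [b [b' [bc b'c bb']]] := two c.
  have [qb|/(parentE _ _ bc)] := eqVneq (q c) b; last by exists b.
  by exists b'; apply: parentE; rewrite // qb.
apply/idP/idP => [bc|/orP[/eqP/pP[]//|/eqP<-]]; last by have [] := qP c.
by have [_|/(parentE _ _ bc)->] := eqVneq (q c) b; rewrite ?eqxx ?orbT.
Qed.

(** * Connectedness and acyclicity of the block tree *)

Section BlockTree.
Variable G : sgraph.
Hypothesis conG : connected G.

Local Notation e := (@edge G).
Local Notation blk := {S : {set G} | block S}.
Local Notation cut := {v : G | cut_vertex v}.
Let e_sym : symmetric e := @edge_sym G.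

Definition block_inc (b : blk) (c : cut) : bool :=
  val c \in val b.

(** An invariant predicate on the tree descends to the vertices of [G], since distinct blocks
    sharing a vertex share a cut vertex. Connectedness of [G] makes it constant. *)
Lemma block_tree_connected (b0 : blk) :
  connected_in (incidence_rel block_inc) [set: block_tree_vertex G].
Proof.
set t := incidence_rel block_inc.
have t_sym : symmetric t := @incidence_sym _ _ block_inc.
apply: (connected_hub t_sym (z := inl b0)) => Q invQ x _.
have same (b b' : blk) v : v \in val b -> v \in val b' -> Q (inl b) = Q (inl b').
  have [-> //|bb'] := eqVneq b b' => vb vb'.
  have cut_v : cut_vertex v by apply: (cut_vertex_mem conG (valP b) (valP b')).
  pose c : cut := Sub v cut_v.
  by rewrite (invQ (inl b) (inr c)) ?(invQ (inr c) (inl b')).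
pose R v := [exists b : blk, (v \in val b) && Q (inl b)].
have RE (b : blk) v : v \in val b -> R v = Q (inl b).
  move=> vb; apply/existsP/idP => [[b' /andP[vb' Qb']]|Qb].
    by rewrite (same b b' v).
  by exists b; rewrite vb.
have invR : invariant_on e [set: G] R.
  move=> u v _ _ uv; have [S blS /andP[uS vS]] := edge_block conG uv.
  by rewrite (RE (Sub S blS) u) // (RE (Sub S blS) v).
have Rconst := connected_inP e_sym _ conG _ invR.
have Qb (b : blk) : Q (inl b) = Q (inl b0).
  have nonempty b1 : exists u, u \in val (b1 : blk).
    have /and3P[b1_gt1 _ _] := block_ns conG (valP b1).
    by apply/card_gt0P; apply: ltnW.
  have [[u ub] [v vb0]] := (nonempty b, nonempty b0).
  by rewrite -(RE b u ub) -(RE b0 v vb0); apply: Rconst.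
case: x => [b|c]; first exact: Qb.
have [S [_ [blS _ cS _ _]]] := cut_vertex_blocks conG (valP c).
by rewrite -(Qb (Sub S blS)); apply: invQ.
Qed.

(** Each node other than [c] lies on one side of [c] in [G], and the side does not change along a
    walk avoiding [c]; then [block_eq] applies. *)
Lemma block_tree_acyclic c b b' : block_inc b c -> block_inc b' c ->
  connect (restr (incidence_rel block_inc) [set~ inr c]) (inl b) (inl b') -> b = b'.
Proof.
set t := incidence_rel block_inc => bc b'c con.
have t_sym : symmetric t := @incidence_sym _ _ block_inc.
have [s sb sc] := nonsep_other (val c) (block_ns conG (valP b)).
pose side := connect (restr e [set~ val c]) s.
have sideE (b1 : blk) :
  {in val b1 :\ val c &, forall x y, side x = side y}.
  have conD := nonsepD1 (val c) (block_ns conG (valP b1)).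
  apply: (connected_sub_inv e_sym conD _ (@avoid_invariant _ _ e_sym (val c) s)).
  by apply/subsetP => x; rewrite !inE => /andP[].
pose L (x : block_tree_vertex G) := match x with
  | inl b1 => [exists z in val b1 :\ val c, side z]
  | inr c1 => side (val c1) end.
have LE (b1 : blk) z : z \in val b1 :\ val c -> L (inl b1) = side z.
  move=> zb; apply/exists_inP/idP => [[y yb]|sz]; last by exists z.
  by rewrite (sideE b1 y z).
have clL : closed (restr t [set~ inr c]) L.
  have cl1 (b1 : blk) (c1 : cut) :
      c1 != c -> block_inc b1 c1 -> L (inl b1) = L (inr c1).
    by move=> c1c b1c1; apply: LE; rewrite in_setD1; apply/andP.
  by case=> [b1|c1] [b2|c2] /and3P[]; rewrite !in_setC1 => xc yc // bc1;
    [apply: cl1 | apply/esym/cl1].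
have Lb : L (inl b) by rewrite (LE b s) ?in_setD1 ?sb ?sc // /side connect0.
have: L (inl b') by have := closed_connect clL con; rewrite ![_ \in L]/in_mem /= => <-.
case/exists_inP=> s'.
rewrite in_setD1 => /andP[s'c s'b'] ss'.
by apply/val_inj; apply: (block_eq conG (valP b) (valP b') bc b'c sb s'b' sc).
Qed.

(** The node [x] ensures that there is a block to serve as root. *)
Lemma block_tree_rooted (x : block_tree_vertex G) :
  exists b0 p q ord, rooted_at block_inc b0 p q ord.
Proof.
have two c : exists b b', [/\ block_inc b c, block_inc b' c & b != b'].
  have [S [S' [blS blS' cS cS' SS']]] := cut_vertex_blocks conG (valP c).
  by exists (Sub S blS), (Sub S' blS').
have [b0] : inhabited blk.
  by case: x => [b|c] //; have [b [_ [_ _ _]]] := two c.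
exists b0; apply: rooted_tree two block_tree_acyclic.
exact: block_tree_connected.
Qed.

End BlockTree.

(** * Minor models *)

Lemma rel_iso_sym (V W : finType) (e : rel V) (f : rel W) : rel_iso e f -> rel_iso f e.
Proof.
case=> h [g hK gK] hE; exists g; first by exists h.
by move=> x y; rewrite -hE !gK.
Qed.

Lemma rel_iso_trans (U V W : finType) (d : rel U) (e : rel V) (f : rel W) :
  rel_iso d e -> rel_iso e f -> rel_iso d f.
Proof.
case=> h h_bij hE [g g_bij gE]; exists (g \o h); first exact: bij_comp.
by move=> x y /=; rewrite gE hE.
Qed.

(* A minor model: the sets [phi @^-1 (Some w)] are the branch sets, and
   [phi x = None] means that [x] is deleted. *)
Record model (V W : finType) (e : rel V) (f : rel W) (phi : V -> option W) : Prop := Model {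
  model_surj : forall w, exists x, phi x = Some w;
  model_conn : forall w, connected_in e [set x | phi x == Some w];
  model_edge : forall w w', f w w' ->
    exists x y, [/\ phi x = Some w, phi y = Some w' & e x y]
}.

(** A branch set of the composite is a union of branch sets of [phi]. An invariant predicate is
    constant on each of these, and so descends to a branch set of [psi]. *)
Lemma model_comp (U V W : finType) (d : rel U) (e : rel V) (f : rel W) phi psi :
    symmetric d -> symmetric e -> model d e phi -> model e f psi ->
  model d f (obind psi \o phi).
Proof.
move=> d_sym e_sym [surj conn edg] [surj' conn' edg']; split=> [w|w|w w'].
- have [v vw] := surj' w; have [x xv] := surj v.
  by exists x; rewrite /= xv.
- apply/(connected_inP d_sym) => Q invQ x y; rewrite !inE /=.
  case def_x: (phi x) => [v|] //= vw; case def_y: (phi y) => [v'|] //= v'w.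
  have fibre_sub t : psi t == Some w ->
      [set z | phi z == Some t] \subset [set z | obind psi (phi z) == Some w].
    by move=> tw; apply/subsetP => z; rewrite !inE => /eqP->.
  have Qfib t : psi t == Some w -> {in [set z | phi z == Some t] &, forall z z', Q z = Q z'}.
    by move=> /fibre_sub sub; apply: (connected_sub_inv d_sym (conn t) sub invQ).
  pose R t := [exists z, (phi z == Some t) && Q z].
  have RE z t : psi t == Some w -> phi z = Some t -> R t = Q z.
    move=> tw zt; apply/existsP/idP => [[z' /andP[z't Qz']]|Qz].
      by rewrite (Qfib t tw z z') ?inE // zt.
    by exists z; rewrite zt eqxx.
  rewrite -(RE x v) // -(RE y v') //.
  apply: (connected_inP e_sym _ (conn' w)); rewrite ?inE // => a b.
  rewrite !inE => aw bw /edg[z [z' [za z'b zz']]].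
  by rewrite (RE z a) // (RE z' b) //; apply: invQ; rewrite ?inE /= ?za ?z'b.
case/edg'=> v [v' [vw v'w /edg[x [y [xv yv' xy]]]]].
by exists x, y; rewrite /= xv yv'.
Qed.

Lemma model_iso (V W : finType) (e : rel V) (f : rel W) :
  symmetric e -> rel_iso e f -> exists phi, model e f phi.
Proof.
move=> e_sym [h [g hK gK] hE]; exists (Some \o h); split=> [w|w|w w' ww'].
- by exists (g w); rewrite /= gK.
- have -> : [set x | (Some \o h) x == Some w] = [set g w]; last exact: connected_in1.
  by apply/setP => x; rewrite !inE /= (inj_eq (@Some_inj _)) (can2_eq hK gK).
by exists (g w), (g w'); rewrite /= !gK -hE !gK.
Qed.

Section Steps.
Variables (V : finType) (e : rel V).
Hypotheses (e_sym : symmetric e) (e_irr : irreflexive e).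

Lemma model_del_edge u v : exists phi, model e (del_edge e u v) phi.
Proof.
exists Some; split=> [w|w|w w' /andP[ww' _]]; first by exists w.
  have -> : [set x | Some x == Some w] = [set w]; last exact: connected_in1.
  by apply/setP => x; rewrite !inE (inj_eq (@Some_inj _)).
by exists w, w'.
Qed.

Lemma model_del_vertex v : exists phi, model e (@del_vertex _ e v) phi.
Proof.
exists insub; split=> [w|w|w w' ww']; first by exists (val w); rewrite valK.
  have -> : [set x | insub x == Some w] = [set val w]; last exact: connected_in1.
  apply/setP => x; rewrite !inE; apply/eqP/eqP => [|->]; last exact: valK.
  by case: insubP => // y _ <- [->].
by exists (val w), (val w'); rewrite !valK.
Qed.

Lemma model_contract u v : e u v -> exists phi, model e (@contract _ e u v) phi.
Proof.
move=> uv; have uDv : u != v by apply: contraTneq uv => ->; rewrite e_irr.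
pose u' : {x : V | x != v} := Sub u uDv.
pose phi x := if x == v then Some u' else insub x.
have phi_val w : phi (val w) = Some w by rewrite /phi (negPf (valP w)) valK.
have phi_v : phi v = Some u' by rewrite /phi eqxx.
have phiP x w : phi x = Some w -> x = val w \/ x = v /\ w = u'.
  rewrite /phi; case: eqVneq => [-> [<-]|_]; first by right.
  by case: insubP => // y _ <- [->]; left.
exists phi; split=> [w|w|w w'].
- by exists (val w).
- have [w_u|wu] := eqVneq w u'.
    have -> : [set x | phi x == Some w] = [set u; v]; last exact: connected_in2.
    apply/setP => x; rewrite !inE; apply/eqP/orP => [/phiP[->|[-> _]]|[/eqP->|/eqP->]].
    + by left; rewrite w_u.
    + by right.
    + by rewrite w_u -phi_val.
    by rewrite phi_v w_u.
  have -> : [set x | phi x == Some w] = [set val w]; last exact: connected_in1.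
  apply/setP => x; rewrite !inE; apply/eqP/eqP => [/phiP[//|[_ wu']]|-> //].
  by rewrite wu' eqxx in wu.
case/andP=> _ /or3P[ww'|/andP[/eqP wu vw']|/andP[/eqP w'u wv]].
- by exists (val w), (val w').
- exists v, (val w'); split=> //; rewrite phi_v; congr Some; exact/val_inj.
by exists (val w), v; split=> //; rewrite phi_v; congr Some; apply/val_inj.
Qed.

End Steps.

Lemma minor_model (H G : sgraph) : minor H G -> exists phi, model (@edge G) (@edge H) phi.
Proof.
elim=> [K /rel_iso_sym/model_iso|K L KL _ [psi mod_psi]].
  by apply; apply: edge_sym.
suff [phi mod_phi] : exists phi, model (@edge K) (@edge L) phi.
  by exists (obind psi \o phi); apply: model_comp mod_psi; rewrite //; apply: edge_sym.
(* The result of a step is given only up to isomorphism; one more composition absorbs this. *)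
have compose (W : finType) (f : rel W) : symmetric f ->
    (exists phi, model (@edge K) f phi) -> rel_iso f (@edge L) ->
    exists phi, model (@edge K) (@edge L) phi.
  move=> f_sym [phi mod_phi] /(model_iso f_sym)[chi mod_chi].
  by exists (obind chi \o phi); apply: model_comp mod_phi mod_chi; rewrite //; apply: edge_sym.
have K_sym := @edge_sym K.
case: KL => [u v uv|v|u v uv]; apply: compose.
- by move=> x y; rewrite /del_edge /= edge_sym setUC.
- exact: model_del_edge.
- by move=> x y; rewrite /del_vertex /= edge_sym.
- exact: model_del_vertex.
- move=> x y; rewrite /contract /= eq_sym edge_sym; congr (_ && (_ || _)).
  by rewrite orbC (edge_sym v) (edge_sym _ v).
by apply: model_contract uv; [apply: edge_sym | apply: edge_irrefl].
Qed.

(** * The graph built from a rooted tree *)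

Lemma bij_of_inj_surj (T T' : finType) (h : T -> T') :
  injective h -> (forall y, exists x, h x = y) -> bijective h.
Proof.
move=> h_inj h_surj.
have ex y : exists x, h x == y by have [x <-] := h_surj y; exists x.
have hK y : h (xchoose (ex y)) = y := eqP (xchooseP (ex y)).
by exists (fun y => xchoose (ex y)) => [x|y] //; apply: h_inj.
Qed.

Lemma card_avoid (T : finType) (A Y : {set T}) : #|Y| < #|A| -> exists2 x, x \in A & x \notin Y.
Proof.
move=> YA; apply/subsetPn; apply: contraL YA => /subset_leq_card.
by rewrite -leqNgt.
Qed.

(** * Ancestors and descendants in a rooted tree *)

Section RootedTreeTheory.
Variables (B C : finType) (I : B -> C -> bool).
Variables (b0 : B) (p : B -> option C) (q : C -> B) (ord : B -> nat).
Hypothesis tree : rooted_at I b0 p q ord.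

Lemma p_inc b c : p b = Some c -> I b c.
Proof. by move=> bc; rewrite (incE tree) bc eqxx. Qed.

Lemma q_inc c : I (q c) c.
Proof. by rewrite (incE tree) eqxx orbT. Qed.

Lemma incP b c : I b c -> p b = Some c \/ q c = b.
Proof. by rewrite (incE tree) => /orP[/eqP|/eqP]; [left | right]. Qed.

Lemma p_root : p b0 = None.
Proof. by apply/eqP; rewrite (root_top tree). Qed.

Lemma block_ind (P : B -> Prop) :
  P b0 -> (forall b c, p b = Some c -> P (q c) -> P b) -> forall b, P b.
Proof.
move=> P0 Pstep b; have [n] := ubnP (ord b).
elim: n b => // n IHn b bn; case def_p: (p b) => [c|].
  apply: (Pstep _ _ def_p); apply: IHn.
  by have := ord_parent tree def_p; lia.
by move/eqP: def_p; rewrite (root_top tree) => /eqP->.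
Qed.

(** The root is its own parent, which makes the ancestors of a node the iterates of a total
    function. *)
Definition parent (x : B + C) : B + C :=
  match x with
  | inl b => if p b is Some c then inr c else inl b
  | inr c => inl (q c)
  end.

(* [desc t x]: [t] lies on the way from [x] up to the root. *)
Definition desc (t x : B + C) := fconnect parent x t.

Lemma descE t x : desc t x = (x == t) || desc t (parent x).
Proof. exact: fconnect_eqVf. Qed.

Lemma desc_refl t : desc t t. Proof. exact: connect0. Qed.

Lemma desc_root_block x : desc (inl b0) x.
Proof.
have desc_b b : desc (inl b0) (inl b).
  elim/block_ind: b => [|b c bc IHb]; first exact: desc_refl.
  by rewrite descE /= bc descE /= IHb orbT.
by case: x => [b|c]; [apply: desc_b | rewrite descE /= desc_b].
Qed.

Lemma desc_cut_root c : desc (inr c) (inl b0) = false.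
Proof.
apply/negP => /iter_findex/esym/eqP; rewrite iter_fix //=.
by rewrite p_root.
Qed.

Lemma desc_cut_block c b : desc (inr c) (inl b) -> ord (q c) < ord b.
Proof.
elim/block_ind: b => [|b c' bc' IHb]; first by rewrite desc_cut_root.
have lt_b := ord_parent tree bc'.
rewrite descE /= bc' descE /= => /predU1P[[<-] //|/IHb]; lia.
Qed.

Lemma desc_cut c c' : desc (inr c) (inr c') -> c' != c -> ord (q c) < ord (q c').
Proof.
by rewrite descE /= => /predU1P[[->]|/desc_cut_block]; rewrite ?eqxx.
Qed.

Lemma desc_block_child b x : desc (inl b) x -> x != inl b ->
  exists2 c, q c = b & desc (inr c) x.
Proof.
move=> /iter_findex; elim: (findex _ _ _) => [/= ->|n IHn]; first by rewrite eqxx.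
rewrite iterS; set w := iter n parent x => w_b xb.
have xw : desc w x by apply: fconnect_iter.
case def_w: w w_b => [b1|c] /=; last by case=> <-; exists c; rewrite -?def_w.
by case: (p b1) => // -[b1_b]; apply: IHn => //; rewrite -/w def_w b1_b.
Qed.

End RootedTreeTheory.

(** * The graph, its degrees and its blocks *)

Section Construction.
Variables (B C L : finType) (I : B -> C -> bool).
Variables (b0 : B) (p : B -> option C) (q : C -> B) (ord : B -> nat) (lam : L -> B).
Hypothesis tree : rooted_at I b0 p q ord.

(* The non-cut vertices of each block are copies of [core]. *)
Definition core : finType := (L * {set C})%type.

(** The symmetric difference of [A] and the singleton of [c]: each [c] yields a perfect matching of
    the subsets of [C], and different [c] yield disjoint ones. *)
Definition toggle (c : C) (A : {set C}) : {set C} := [set z | (z \in A) (+) (z == c)].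

(* The block containing [c] in which the vertices of first coordinate [l] are
   joined to [c]. *)
Definition host (c : C) (l : L) : B := if p (lam l) == Some c then lam l else q c.

(** The coordinates [l] with [lam l = b] are reserved for the cut vertex above [b]; every other cut
    vertex uses them in the block above itself. The fibre sizes of [lam] are the weights of the
    blocks. *)
Definition att (b : B) (l : L) (c : C) : bool := b == host c l.

(* For each attached cut vertex [c] the edge from [x] to its toggled copy is
   missing, so that all core vertices have degree [#|core| - 1]. *)
Definition core_edge (b : B) (x y : core) : bool :=
  (x != y) && ~~ ((x.1 == y.1) && [exists c, att b x.1 c && (y.2 == toggle c x.2)]).

Definition tree_vertex : finType := (B * core + C)%type.

Definition tree_edge : rel tree_vertex := fun u v =>
  match u, v with
  | inl (b, x), inl (b', y) => (b == b') && core_edge b x y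
  | inl (b, x), inr c => att b x.1 c
  | inr c, inl (b, x) => att b x.1 c
  | inr _, inr _ => false
  end.

Lemma toggleK c : involutive (toggle c).
Proof. by move=> A; apply/setP => z; rewrite !inE -addbA addbb addbF. Qed.

Lemma toggle_neq c A : toggle c A != A.
Proof.
apply/eqP => /setP/(_ c); rewrite !inE eqxx addbT.
by case: (c \in A).
Qed.

Lemma toggle_inj A : injective (toggle^~ A).
Proof.
move=> c c' /setP/(_ c); rewrite !inE eqxx addbT.
by case: (c \in A); case: eqVneq.
Qed.

Lemma core_edge_sym b : symmetric (core_edge b).
Proof.
move=> x y; rewrite /core_edge eq_sym [y.1 == _]eq_sym; congr (_ && ~~ _).
have [<-|//] := eqVneq x.1 y.1; apply: eq_existsb => c; congr (_ && _).
by apply/eqP/eqP => ->; rewrite toggleK.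
Qed.

Lemma tree_edge_sym : symmetric tree_edge.
Proof.
case=> [[b x]|c] [[b' y]|c'] //=; rewrite eq_sym core_edge_sym.
by have [->|] := eqVneq b' b.
Qed.

Lemma tree_edge_irrefl : irreflexive tree_edge.
Proof. by case=> [[b x]|c] //=; rewrite /core_edge !eqxx. Qed.

Lemma att_inc b l c : att b l c -> I b c.
Proof.
rewrite /att /host => /eqP->; case: eqP => [/(p_inc tree)//|_].
exact: (q_inc tree).
Qed.

Lemma core_edge_diff b (x y : core) : x.1 != y.1 -> core_edge b x y.
Proof.
move=> xy; rewrite /core_edge (negPf xy) andbT.
by apply: contraNneq xy => ->.
Qed.

Definition attached (b : B) (l : L) : {set C} := [set c | att b l c].

(** The core vertices not adjacent to [x] are [x] itself and its toggled copies, one for each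
    attached cut vertex. *)
Lemma card_core_nbrs b x :
  #|[set y | core_edge b x y]| + #|attached b x.1| = #|core|.-1.
Proof.
pose g c : core := (x.1, toggle c x.2).
have g_inj : injective g by move=> c c' [/toggle_inj].
have xg : x \notin g @: attached b x.1.
  apply/imsetP => -[c _ /(congr1 snd)/= /esym/eqP].
  by rewrite (negPf (toggle_neq _ _)).
have nbrE : [set y | core_edge b x y] = ~: (x |: g @: attached b x.1).
  apply/setP => y; rewrite !inE negb_or /core_edge eq_sym; congr (_ && ~~ _).
  apply/andP/imsetP => [[/eqP xy /existsP[c /andP[cx /eqP yc]]]|[c]].
    by exists c; rewrite ?inE // /g -yc xy; case: (y).
  rewrite inE => cx ->; rewrite /= eqxx; split=> //.
  by apply/existsP; exists c; rewrite cx eqxx.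
have := cardsC (x |: g @: attached b x.1).
by rewrite -nbrE cardsU1 xg (card_imset _ g_inj) -cardsT; lia.
Qed.

Definition nbrs (u : tree_vertex) : {set tree_vertex} := [set v | tree_edge u v].

Lemma card_nbrs_core b x : #|nbrs (inl (b, x))| = #|core|.-1.
Proof.
pose g (y : core) : tree_vertex := inl (b, y).
have g_inj : injective g by move=> y y' [].
have -> : nbrs (inl (b, x)) = g @: [set y | core_edge b x y] :|: inr @: attached b x.1.
  apply/setP => -[[b' y]|c]; rewrite !inE /=.
    rewrite orbC; case: imsetP => [[? _] //|_] /=.
    apply/andP/imsetP => [[/eqP<- xy]|[y']]; first by exists y; rewrite ?inE.
    by rewrite inE => xy' [-> ->].
  case: imsetP => [[? _] //|_] /=.
  by rewrite mem_imset ?inE // => ? ? [].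
rewrite cardsU disjoint_setI0 ?cards0 ?subn0; last first.
  rewrite disjoint_subset; apply/subsetP => v /imsetP[y _ ->].
  by apply/negP => /imsetP[].
by rewrite !card_imset ?card_core_nbrs // => ? ? [].
Qed.

Lemma card_nbrs_cut c : #|core| <= #|nbrs (inr c)|.
Proof.
pose g (x : core) : tree_vertex := inl (host c x.1, x).
have g_inj : injective g by move=> x y [].
rewrite -cardsT -(card_imset _ g_inj); apply: subset_leq_card.
by apply/subsetP => _ /imsetP[x _ ->]; rewrite inE /= /att.
Qed.

Definition body (b : B) (u : tree_vertex) : bool :=
  match u with inl (b', _) => b' == b | inr c => I b c end.

Definition body_set b : {set tree_vertex} := [set u | body b u].

Lemma tree_edge_body u v : tree_edge u v -> exists b, body b u && body b v.
Proof.
case: u v => [[b x]|c] [[b' y]|c'] //=.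
- by case/andP=> /eqP-> _; exists b'; rewrite eqxx.
- by move/att_inc => bc'; exists b; rewrite eqxx.
by move/att_inc => bc; exists b'; rewrite eqxx andbT.
Qed.

Definition pos (u : tree_vertex) : B + C :=
  match u with inl (b, _) => inl b | inr c => inr c end.

(** Passing between [b] and a cut vertex of [b] changes descent from [t] only if [t] is the lower of
    the two nodes, which the hypotheses exclude. *)
Lemma desc_body t b u : body b u ->
    (forall c, u = inr c -> q c = b -> t != inr c) ->
    (forall c, u = inr c -> p b = Some c -> t != inl b) ->
  desc p q t (pos u) = desc p q t (inl b).
Proof.
case: u => [[b' x]|c] /=; first by move=> /eqP->.
move=> /(incP tree)[bc _ /(_ c erefl bc) tb|qb /(_ c erefl qb) tc _].
  by rewrite [RHS]descE /= bc eq_sym (negPf tb).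
by rewrite descE /= qb eq_sym (negPf tc).
Qed.

(** Descent from [c] changes only between [c] and the block above it, and edges avoiding [c] do not
    cross there. *)
Lemma desc_cut_invariant c :
  invariant_on tree_edge [set~ inr c] (fun u => desc p q (inr c) (pos u)).
Proof.
have descb b u : u != inr c -> body b u ->
    desc p q (inr c) (pos u) = desc p q (inr c) (inl b).
  by move=> uc bu; apply: desc_body bu _ _ => // c' u_c' _; apply: contraNneq uc => -[->]; rewrite u_c'.
move=> u v; rewrite !inE => uc vc /tree_edge_body[b /andP[bu bv]].
by rewrite (descb b u) ?(descb b v).
Qed.

Lemma desc_block_invariant b c : p b = Some c ->
  invariant_on tree_edge [set~ inr c] (fun u => desc p q (inl b) (pos u)).
Proof.
move=> bc.
have descb b1 u : u != inr c -> body b1 u ->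
    desc p q (inl b) (pos u) = desc p q (inl b) (inl b1).
  move=> uc b1u; apply: desc_body b1u _ _ => // c' u_c' b1c'.
  by apply: contraNneq uc => -[bb1]; move: b1c'; rewrite -bb1 bc u_c' => -[->].
move=> u v; rewrite !inE => uc vc /tree_edge_body[b1 /andP[bu bv]].
by rewrite (descb b1 u) ?(descb b1 v).
Qed.

Hypothesis lam_large : forall b, 2 * #|C| + 4 <= #|[set l | lam l == b]|.

(** A block below [c] offers its own coordinates; the block above [c] offers at least those of [b0],
    which has no cut vertex above it. *)
Lemma att_many b c : I b c -> 2 * #|C| + 4 <= #|[set l | att b l c]|.
Proof.
case/(incP tree) => [bc|qb].
  apply: leq_trans (lam_large b) _; apply: subset_leq_card.
  by apply/subsetP => l; rewrite !inE /att /host => /eqP->; rewrite bc !eqxx.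
apply: leq_trans (lam_large b0) _; apply: subset_leq_card.
apply/subsetP => l; rewrite !inE /att /host => /eqP->.
by rewrite (p_root tree) qb eqxx.
Qed.

Lemma card_L : 2 * #|C| + 4 <= #|L|.
Proof. by apply: leq_trans (lam_large b0) _; apply: max_card. Qed.

Lemma avoid_L (Y : {set L}) : #|Y| < 4 -> exists l, l \notin Y.
Proof.
move=> Y4; have [|l _ lY] := @card_avoid _ setT Y; last by exists l.
by rewrite cardsT; have := card_L; lia.
Qed.

(** The exempted coordinate [l0] lets one lemma cover the body both whole and with one vertex
    deleted. Core vertices with distinct coordinates are adjacent, so few spare coordinates
    suffice. *)
Lemma body_connected b l0 (T : {set tree_vertex}) :
    T \subset body_set b -> (forall l A, l != l0 -> inl (b, (l, A)) \in T) ->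
  connected_in tree_edge T.
Proof.
move=> /subsetP Tb T_l.
have [l1] : exists l, l \notin [set l0] by apply: avoid_L; rewrite cards1.
rewrite inE => l10; apply: (connected_hub tree_edge_sym (z := inl (b, (l1, set0)))).
move=> Q invQ.
have near l A : l != l1 -> inl (b, (l, A)) \in T -> Q (inl (b, (l, A))) = Q (inl (b, (l1, set0))).
  by move=> ll1 lT; apply: invQ; [|exact: T_l | rewrite /= eqxx core_edge_diff].
case=> [[b' [l A]]|c] uT.
  have /eqP b'b : b' == b by have := Tb _ uT; rewrite inE.
  rewrite b'b in uT *; have [ll1|] := eqVneq l l1; last by move/near; apply.
  have [l2] : exists l, l \notin [set l0; l1].
    by apply: avoid_L; rewrite cards2; case: (_ != _).
  rewrite !inE negb_or => /andP[l20 l21].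
  rewrite -(near l2 set0) ?T_l //; apply: invQ; [done | exact: T_l|].
  by rewrite /= eqxx core_edge_diff //= ll1 eq_sym.
have bc : I b c by have := Tb _ uT; rewrite inE.
have [|l] := @card_avoid _ [set l | att b l c] [set l0; l1].
  by rewrite cards2; have := att_many bc; case: (_ != _); lia.
rewrite !inE negb_or => lc /andP[ll0 ll1].
by rewrite -(near l set0) ?T_l //; apply: invQ => //; apply: T_l.
Qed.

Lemma body_nonsep b : nonseparable tree_edge (body_set b).
Proof.
have [l0 _] : exists l, l \notin (set0 : {set L}) by apply: avoid_L; rewrite cards0.
have [l1] : exists l, l \notin [set l0] by apply: avoid_L; rewrite cards1.
rewrite inE => l10; apply/and3P; split.
- apply/card_gt1P; exists (inl (b, (l0, set0))), (inl (b, (l1, set0))).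
  by rewrite !inE /= eqxx; split=> //; apply: contraNneq l10 => -[->].
- by apply: (@body_connected b l0) => // l A _; rewrite inE /=.
apply/forall_inP => u _.
pose lu := if u is inl (_, (l, _)) then l else l0.
apply: (@body_connected b lu); first exact: subD1set.
move=> l A; rewrite !inE /= eqxx andbT /lu.
by case: u {lu} => // -[b' [l' A']]; apply: contraNneq => -[_ ->].
Qed.

Lemma core_nonempty : 0 < #|core|.
Proof.
have [l _] : exists l, l \notin (set0 : {set L}) by apply: avoid_L; rewrite cards0.
by apply/card_gt0P; exists (l, set0).
Qed.

Lemma tree_nonempty : 0 < #|tree_vertex|.
Proof.
have [x _] := card_gt0P core_nonempty.
by apply/card_gt0P; exists (inl (b0, x)).
Qed.

Definition tree_graph : sgraph :=
  SGraph tree_edge_sym tree_edge_irrefl tree_nonempty.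

(** Connectedness spreads downwards from [b0] through the shared cut vertices. It serves for the
    whole graph and for the graph minus a core vertex. *)
Lemma glue_bodies (T : {set tree_vertex}) z :
    (forall b, connected_in tree_edge (body_set b :&: T)) ->
    (forall c, inr c \in T) -> z \in body_set b0 :&: T ->
  connected_in tree_edge T.
Proof.
move=> conb cT zT; apply: (connected_hub tree_edge_sym (z := z)) => Q invQ.
have Qb b : {in body_set b :&: T &, forall u v, Q u = Q v}.
  by apply: (connected_sub_inv tree_edge_sym (conb b) _ invQ); apply: subsetIr.
have Qz b : {in body_set b :&: T, forall u, Q u = Q z}.
  elim/(block_ind tree): b => [|b c bc IHb] u uT; first exact: (Qb b0).
  rewrite -(IHb (inr c)); last by rewrite inE cT andbT inE; apply: (q_inc tree).
  by apply: (Qb b) => //; rewrite inE cT andbT inE; apply: (p_inc tree).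
case=> [[b x]|c] uT; first by apply: (Qz b); rewrite inE uT andbT inE /=.
by apply: (Qz (q c)); rewrite inE uT andbT inE; apply: (q_inc tree).
Qed.

Lemma tree_connected : connected tree_graph.
Proof.
have [x _] := card_gt0P core_nonempty.
apply: (glue_bodies (z := inl (b0, x))) => [b|c|]; rewrite ?inE //= ?eqxx //.
by rewrite setIT; have /and3P[] := body_nonsep b.
Qed.

Lemma tree_cut_vertex u : @cut_vertex tree_graph u = (if u is inr _ then true else false).
Proof.
case: u => [[b x]|c]; rewrite /cut_vertex; last first.
  apply/negP => conc; have [b bc] := has_child tree c.
  have [x _] := card_gt0P core_nonempty.
  have := connected_inP tree_edge_sym _ conc _ (@desc_cut_invariant c)
    (inl (b, x)) (inl (q c, x)).
  rewrite !inE => /(_ isT isT) /=; rewrite descE /= bc desc_refl /=.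
  by move/esym/(desc_cut_block tree); rewrite ltnn.
apply/negbTE; rewrite negbK.
have [l] : exists l, l \notin [set x.1] by apply: avoid_L; rewrite cards1.
rewrite inE => lx.
apply: (glue_bodies (z := inl (b0, (l, set0)))) => [b'|c|]; rewrite ?inE //= ?eqxx //=.
  by rewrite -setDE; apply: nonsepD1; apply: body_nonsep.
by apply: contraNneq lx => -[_ <-].
Qed.

(** A vertex outside the body is separated from the core of [b] by a single cut vertex: one below
    [b] if it descends from [b], otherwise the one above [b]. *)
Lemma body_maxset b : maxset (nonseparable tree_edge) (body_set b).
Proof.
apply/maxsetP; split=> [|U nsU bU]; first exact: body_nonsep.
apply/eqP; rewrite eq_sym eqEsubset bU; apply/subsetP => u uU; rewrite inE.
apply: contraT => ub.
have [x _] := card_gt0P core_nonempty.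
have bx : inl (b, x) \in U by apply: (subsetP bU); rewrite inE /=.
have UD c : U :\ inr c \subset [set~ inr c] by apply/subsetP => v; rewrite !inE => /andP[].
have conU c Q : invariant_on tree_edge [set~ inr c] Q ->
    {in U :\ inr c &, forall u v, Q u = Q v}.
  exact: (connected_sub_inv tree_edge_sym (nonsepD1 (inr c) nsU) (UD c)).
have [u_desc|u_ndesc] := boolP (desc p q (inl b) (pos u)).
  have [|c qc uc] := desc_block_child u_desc.
    by apply: contraNneq ub; case: u {uU u_desc} => [[b' y]|c] //= [->].
  have u_c : u != inr c by apply: contraNneq ub => ->; rewrite /= -qc (q_inc tree).
  have := conU c _ (@desc_cut_invariant c) u (inl (b, x)).
  rewrite !inE u_c uU bx => /(_ isT isT); rewrite uc => /esym/(desc_cut_block tree).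
  by rewrite qc ltnn.
case def_p: (p b) => [c|]; last first.
  by move/eqP: def_p u_ndesc; rewrite (root_top tree) => /eqP->; rewrite (desc_root_block tree).
have u_c : u != inr c by apply: contraNneq ub => ->; rewrite /= (p_inc tree).
have := conU c _ (desc_block_invariant def_p) u (inl (b, x)).
by rewrite !inE u_c uU bx => /(_ isT isT); rewrite (negPf u_ndesc) /= desc_refl.
Qed.

Lemma body_block b : @block tree_graph (body_set b).
Proof. by rewrite (block_nonsep tree_connected); apply: body_maxset. Qed.

(** A block contains an edge, that edge lies in some body, and two blocks sharing an edge are
    equal. *)
Lemma block_body (U : {set tree_graph}) : block U -> exists b, U = body_set b.
Proof.
move=> blU; have nsU := block_ns tree_connected blU.
have [U_gt1 conU _] := and3P nsU.
have [u uU] : exists u, u \in U by apply/card_gt0P; apply: ltnW.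
have [v vU vu] := nonsep_other u nsU.
have [/exists_inP[a aU /exists_inP[a' a'U aa']]|noedge] :=
  boolP [exists a in U, exists a' in U, tree_edge a a']; last first.
  have invQ : invariant_on tree_edge U (pred1 u).
    move=> a a' aU a'U aa'; case/negP: noedge.
    by apply/exists_inP; exists a => //; apply/exists_inP; exists a'.
  have := connected_inP tree_edge_sym _ conU _ invQ u v uU vU.
  by rewrite /= eqxx (negPf vu).
have [b /andP[ba ba']] := tree_edge_body aa'; exists b.
apply: (block_eq tree_connected blU (body_block b) aU _ a'U _ _ (connect0 _ _)).
- by rewrite inE.
- by rewrite inE.
by apply: contraTneq aa' => ->; rewrite tree_edge_irrefl.
Qed.

Lemma tree_block_tree : rel_iso (incidence_rel I) (@block_tree_edge tree_graph).
Proof.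
have cutr c : @cut_vertex tree_graph (inr c) by rewrite tree_cut_vertex.
pose h (x : B + C) : block_tree_vertex tree_graph := match x with
  | inl b => inl (Sub (body_set b) (body_block b))
  | inr c => inr (Sub (inr c : tree_graph) (cutr c)) end.
exists h; last by case=> [b|c] [b'|c'] //=; rewrite inE.
apply: bij_of_inj_surj.
  case=> [b|c] [b'|c'] //= => [[/setP bb']|[->]] //.
  have [x _] := card_gt0P core_nonempty.
  by have := bb' (inl (b, x)); rewrite !inE /= eqxx => /esym/eqP->.
case=> [[U blU]|[[[b x]|c] cut_u]].
- have [b U_b] := block_body blU; exists (inl b); congr inl.
  by apply: val_inj; rewrite /= U_b.
- by exfalso; rewrite tree_cut_vertex in cut_u.
by exists (inr c); congr inr; apply: val_inj.
Qed.

End Construction.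

(** * Rigidity of minors of large minimum degree *)

Lemma card_option_image (T T' : finType) (K : {set T}) (g : T -> option T') :
  #|[set h | [exists t in K, g t == Some h]]| <= #|K|.
Proof.
rewrite -(card_imset _ (@Some_inj _)); apply: leq_trans (leq_imset_card g (mem K)).
apply: subset_leq_card; apply/subsetP => _ /imsetP[h + ->].
by rewrite inE => /exists_inP[t tK /eqP<-]; apply: imset_f.
Qed.

Section Rigidity.
Variables (B C L : finType) (I : B -> C -> bool).
Variables (b0 : B) (p : B -> option C) (q : C -> B) (ord : B -> nat) (lam : L -> B).
Hypothesis tree : rooted_at I b0 p q ord.
Hypothesis lam_large : forall b, 2 * #|C| + 4 <= #|[set l | lam l == b]|.
Hypothesis lam_dom : forall b,
  #|[set l | ord b < ord (lam l)]| + 2 <= #|[set l | lam l == b]|.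

Local Notation core := (core C L).
Local Notation V := (tree_vertex B C L).
Local Notation E := (@tree_edge B C L p q lam).
Local Notation att := (att p q lam).
Local Notation host := (host p q lam).
Local Notation core_edge := (core_edge p q lam).
Local Notation attached := (attached p q lam).

Let E_sym : symmetric E := @tree_edge_sym B C L p q lam.

Variables (H : sgraph) (phi : V -> option H).
Hypothesis mod_phi : model E (@edge H) phi.
Hypothesis deg_H : forall h : H, #|core|.-1 <= degree h.

Let surj := model_surj mod_phi.
Let conn := model_conn mod_phi.
Let medge := model_edge mod_phi.

Definition core_set (b : B) : {set V} :=
  [set u : V | if u is inl (b', _) then b' == b else false].

Definition internal b (h : H) : bool := [set u | phi u == Some h] \subset core_set b.

Lemma internalP b h u : internal b h -> phi u = Some h -> exists x, u = inl (b, x).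
Proof.
move=> /subsetP int uh; have := int u; rewrite !inE uh eqxx => /(_ isT).
by case: u {uh} => [[b' x]|c] // /eqP->; exists x.
Qed.

(** A connected set can leave the core of [b] only through a cut vertex of [b]. *)
Lemma branch_cases b x h : phi (inl (b, x)) = Some h ->
  internal b h \/ exists2 c, I b c & phi (inr c) = Some h.
Proof.
move=> xh.
have [/exists_inP[c bc /eqP ch]|noc] := boolP [exists c in I b, phi (inr c) == Some h].
  by right; exists c.
left; apply/subsetP => u; rewrite inE => uh.
have noc_att y c : att b y c -> phi (inr c) != Some h.
  move=> bc; apply: contraNN noc => ch; apply/exists_inP; exists c => //.
  exact: (att_inc tree bc).
suff -> : (u \in core_set b) = (inl (b, x) \in core_set b) by rewrite inE.
apply: (connected_inP E_sym _ (conn h) (mem (core_set b))); rewrite ?inE ?xh //.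
move=> v w; rewrite !inE => /eqP vh /eqP wh.
case: v w vh wh => [[b1 y]|c] [[b2 z]|c'] vh wh //=.
- by case/andP=> /eqP->.
- by move=> bc; apply/eqP => b1_b; rewrite b1_b in bc; have := noc_att _ _ bc; rewrite wh eqxx.
by move=> bc; apply/esym/eqP => b2_b; rewrite b2_b in bc; have := noc_att _ _ bc; rewrite vh eqxx.
Qed.

Lemma internal_or_cut h :
  (exists b, internal b h) \/ exists c, phi (inr c) = Some h.
Proof.
have [[[b x]|c] uh] := surj h; last by right; exists c.
by have [int|[c _ ch]] := branch_cases uh; [left; exists b | right; exists c].
Qed.

(** * A block with an internal branch set survives unchanged *)

Section FullBlock.
Variables (b : B) (h0 : H).
Hypothesis int_h0 : internal b h0.

Let x0 : core := enum_val (Ordinal (core_nonempty b0 lam_large)).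

Let rep (h : H) : core := odflt x0 [pick x | phi (inl (b, x)) == Some h].

Let repP h : internal b h -> phi (inl (b, rep h)) = Some h.
Proof.
move=> int; rewrite /rep; case: pickP => [x /eqP //|nox].
have [u uh] := surj h; have [x u_x] := internalP int uh.
by have := nox x; rewrite -u_x uh eqxx.
Qed.

Let lost : {set core} := ~: rep @: [set h | internal b h].

Let repE x h : x \notin lost -> phi (inl (b, x)) = Some h -> internal b h /\ x = rep h.
Proof.
rewrite inE negbK => /imsetP[h1]; rewrite inE => int ->.
by rewrite repP // => -[<-].
Qed.

Let rep_inj : {in internal b &, injective rep}.
Proof. by move=> h h' int int' hh'; apply: Some_inj; rewrite -!repP // hh'. Qed.

Let card_lost : #|lost| + #|[set h | internal b h]| = #|core|.
Proof.
rewrite addnC -(cardsC (rep @: [set h | internal b h])) card_in_imset //.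
by move=> h h'; rewrite !inE; apply: rep_inj.
Qed.

(** Each neighbour of [h0] is internal to [b] or contains a cut vertex, so the degree of [h0] forces
    all but at most [#|C|] core vertices to be representatives. *)
Let lost_le : #|lost| <= #|C|.
Proof.
pose RB := [set h | [exists c in [set: C], phi (inr c) == Some h]].
have RB_le : #|RB| <= #|C| by rewrite -cardsT; apply: card_option_image.
have: degree h0 <= #|[set h | internal b h] :\ h0| + #|RB|.
  rewrite -cardsUI; apply: leq_trans (leq_addr _ _); apply: subset_leq_card.
  apply/subsetP => h; rewrite !inE => h0h.
  have hh0 : h != h0 by apply: contraTneq h0h => ->; rewrite edge_irrefl.
  have [u [v [uh0 vh uv]]] := medge h0h.
  have [x u_x] := internalP int_h0 uh0; rewrite u_x in uv.
  have cutR c : phi (inr c) = Some h -> [exists c in [set: C], phi (inr c) == Some h].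
    by move=> ch; apply/exists_inP; exists c; rewrite ?inE ?ch.
  case: v vh uv => [[b' y]|c] vh /=; last by rewrite (cutR c) ?orbT.
  case/andP=> /eqP b_b' _; rewrite -b_b' in vh.
  by have [->|[c _ /cutR->]] := branch_cases vh; rewrite ?hh0 ?orbT.
have := deg_H h0; have := cardsD1 h0 [set h | internal b h].
by rewrite inE int_h0; have := card_lost; lia.
Qed.

(* The first coordinates of the vertices affected by the losses: a core vertex
   with any other first coordinate is adjacent to all of them. *)
Let touched : {set L} :=
  [set x.1 | x in lost] :|:
  [set (if phi (inl (b, x)) is Some h then (rep h).1 else x.1) | x in lost].

Let touched_le : #|touched| <= 2 * #|C|.
Proof.
apply: leq_trans (leq_card_setU _ _) _; rewrite mul2n -addnn.
by apply: leq_add; apply: leq_trans (leq_imset_card _ _) lost_le.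
Qed.

Let lost_touched x : x \in lost -> x.1 \in touched.
Proof. by move=> xJ; rewrite inE imset_f. Qed.

Let rep_touched x h : x \in lost -> phi (inl (b, x)) = Some h -> (rep h).1 \in touched.
Proof.
by move=> xJ xh; rewrite inE; apply/orP; right; apply/imsetP; exists x; rewrite ?xh.
Qed.

(** Only these can be neighbours of an untouched core vertex without being internal or containing a
    cut vertex attached to it. *)
Let absorbed : {set H} := [set h |
  [exists c in I b, phi (inr c) == Some h] &&
  [exists x in lost, phi (inl (b, x)) == Some h]].

Let absorbed_le : #|absorbed| <= #|lost|.
Proof.
apply: leq_trans (card_option_image lost (fun x => phi (inl (b, x)))).
by apply: subset_leq_card; apply/subsetP => h; rewrite !inE => /andP[].
Qed.

(** The core vertex [(l, set0)] is a branch set by itself and was adjacent to all lost vertices. Its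
    degree can be kept only if absorbed branch sets replace every lost vertex and the attached cut
    vertices give distinct, non-absorbed neighbours. *)
Let untouched l : l \notin touched ->
  #|lost| <= #|absorbed| /\
  forall c, att b l c -> exists2 h, phi (inr c) = Some h & h \notin absorbed.
Proof.
move=> l_un; pose x : core := (l, set0).
have x_lost : x \notin lost by apply: contraNN l_un => /lost_touched.
have [h int_h x_h] : exists2 h, internal b h & x = rep h.
  by move: x_lost; rewrite inE negbK => /imsetP[h]; rewrite inE; exists h.
have xh : phi (inl (b, x)) = Some h by rewrite x_h repP.
have fib_h u : phi u = Some h -> u = inl (b, x).
  move=> uh; have [y u_y] := internalP int_h uh; rewrite u_y in uh *.
  have [/rep_touched/(_ uh)|/repE/(_ uh)[_ ->]] := boolP (y \in lost); last by rewrite x_h.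
  by rewrite -x_h (negPf l_un).
pose A1 := [set h' | internal b h' & core_edge b x (rep h')].
pose A2 := [set h' | [exists c in attached b l, phi (inr c) == Some h']].
have A2_le : #|A2| <= #|attached b l| by apply: card_option_image.
have lost_nbr y : y \in lost -> core_edge b x y.
  move=> /lost_touched yl; apply: core_edge_diff.
  by apply: contraNneq l_un => /= ->.
have A1_le : #|A1| + #|lost| + #|attached b l| <= #|core|.-1.
  rewrite -(card_core_nbrs p q lam b x) leq_add2r.
  have rep_A1 : {in A1 &, injective rep}.
    by move=> ? ?; rewrite !inE => /andP[? _] /andP[? _]; apply: rep_inj.
  rewrite -(card_in_imset rep_A1) -cardsUI.
  rewrite [X in _ + X](_ : _ = 0) ?addn0; last first.
    apply/eqP; rewrite cards_eq0 -subset0; apply/subsetP => y.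
    rewrite inE => /andP[/imsetP[h' + ->]]; rewrite !inE => /andP[int _].
    by rewrite imset_f ?inE.
  apply: subset_leq_card; apply/subsetP => y /setUP[|/lost_nbr]; last by rewrite inE.
  by case/imsetP=> h' + ->; rewrite !inE => /andP[].
have nbr_h : [set h' | edge h h'] \subset A1 :|: (absorbed :|: A2).
  apply/subsetP => h'; rewrite inE => hh'.
  have [u [v [/fib_h u_x vh' uv]]] := medge hh'; rewrite u_x in uv.
  case: v vh' uv => [[b' y]|c] /=; last first.
    move=> ch' bc; rewrite !inE; apply/orP; right; apply/orP; right.
    by apply/exists_inP; exists c; rewrite ?inE ?ch'.
  move=> yh' /andP[/eqP b_b' xy]; rewrite -b_b' in yh'.
  have [int|[c bc ch']] := branch_cases yh'.
    rewrite !inE int /=; apply/orP; left.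
    have [yJ|/repE/(_ yh')[_ <-] //] := boolP (y \in lost).
    apply: core_edge_diff; apply: contraNneq l_un => /= ->.
    exact: rep_touched yJ yh'.
  rewrite inE; apply/orP; right; rewrite 2!inE; apply/orP; left; apply/andP; split.
    by apply/exists_inP; exists c; rewrite ?ch'.
  apply/exists_inP; exists y; rewrite ?yh' //; apply: contraT => /repE/(_ yh')[int _].
  by have [] := internalP int ch'.
(* The sizes of [lost] and of the attached set sum to at most the size of the union of [absorbed]
   and [A2]. As [absorbed_le] and [A2_le] bound the parts, all these bounds are equalities and the
   two sets are disjoint. *)
have := subset_leq_card nbr_h; have := deg_H h; rewrite /degree.
have := (leq_card_setU A1 (absorbed :|: A2)).1; have := cardsUI absorbed A2.
move=> UI le1 le2 le3; have abs_le := absorbed_le.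
split; first lia.
move=> c bc; case ch: (phi (inr c)) => [h'|].
  exists h' => //; apply/negP => h'_abs.
  have: h' \in absorbed :&: A2.
    by rewrite inE h'_abs inE; apply/exists_inP; exists c; rewrite ?inE ?ch.
  by move=> hI; have: 0 < #|absorbed :&: A2| by [apply/card_gt0P; exists h']; lia.
have: #|A2| <= #|attached b l :\ c|.
  apply: leq_trans (card_option_image _ (phi \o inr)); apply: subset_leq_card.
  apply/subsetP => h'; rewrite !inE => /exists_inP[c' c'l c'h']; apply/exists_inP.
  exists c' => //; rewrite !inE; apply/andP; split; last by rewrite inE in c'l.
  by apply: contraTneq c'h' => ->; rewrite ch.
by have := cardsD1 c (attached b l); rewrite inE bc; lia.
Qed.

(** The cut vertex of an absorbed branch set is attached at some untouched coordinate, and there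
    [untouched] denies the absorption. *)
Let no_absorbed : absorbed = set0.
Proof.
apply/eqP; rewrite -subset0; apply/subsetP => h h_abs; exfalso.
move: (h_abs); rewrite inE => /andP[/exists_inP[c bc /eqP ch] _].
have [|l] := @card_avoid _ [set l | att b l c] touched.
  by have := touched_le; have := att_many tree lam_large bc; lia.
rewrite inE => lc /untouched[_ /(_ c lc)[h']].
by rewrite ch => -[<-]; rewrite h_abs.
Qed.

Let no_lost : lost = set0.
Proof.
have [|l _ /untouched[]] := @card_avoid _ setT touched.
  by rewrite cardsT; have := touched_le; have := card_L b0 lam_large; lia.
by rewrite no_absorbed cards0 leqn0 cards_eq0 => /eqP.
Qed.

Lemma full_core x :
  exists2 h, phi (inl (b, x)) = Some h & forall u, phi u = Some h -> u = inl (b, x).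
Proof.
have Jx y : y \notin lost by rewrite no_lost inE.
have := Jx x; rewrite inE negbK => /imsetP[h]; rewrite inE => int ->; exists h; first exact: repP.
move=> u uh; have [y u_y] := internalP int uh; rewrite u_y in uh *.
by have [_ ->] := repE (Jx y) uh.
Qed.

Lemma full_cut c : I b c -> exists h, phi (inr c) = Some h.
Proof.
move=> bc; have [|l] := @card_avoid _ [set l | att b l c] touched.
  by have := touched_le; have := att_many tree lam_large bc; lia.
by rewrite inE => lc /untouched[_ /(_ c lc)[h ch _]]; exists h.
Qed.

End FullBlock.

(** * Propagation of fullness through the tree *)

Definition full b : bool := [exists h, internal b h].

Lemma fullP b : full b -> exists h, internal b h.
Proof. by move/existsP. Qed.

(** The core of a full block consists of singleton branch sets, so the branch set of [c1] cannot
    pass upwards through the block above [c1] and stays below [c1]. *)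
Lemma cut_above c1 c2 h : full (q c1) -> phi (inr c1) = Some h -> phi (inr c2) = Some h ->
  c2 != c1 -> ord (q c1) < ord (q c2).
Proof.
move=> /fullP[h0 int0] c1h c2h; apply: (desc_cut tree).
have invQ : invariant_on E [set u | phi u == Some h] (fun u => desc p q (inr c1) (pos u)).
  have not_core x : phi (inl (q c1, x)) <> Some h.
    by move=> xh; have [h1 + fib] := full_core int0 x; rewrite xh => -[hh1]; have := fib (inr c1); rewrite -hh1 c1h => /(_ erefl).
  have descb b (u : V) : b != q c1 -> body I b u ->
      desc p q (inr c1) (pos u) = desc p q (inr c1) (inl b).
    move=> bq bu; apply: (desc_body tree bu) => // c _ qc.
    by apply: contraNneq bq => -[->]; rewrite qc.
  move=> u v; rewrite !inE => /eqP uh /eqP vh uv.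
  have [b [bu bv [x core_uv]]] : exists b, [/\ body I b u, body I b v &
      exists x, u = inl (b, x) \/ v = inl (b, x)].
    case: u v uv {uh vh} => [[b x]|c] [[b' y]|c'] //=.
    - by case/andP=> /eqP-> _; exists b'; split=> //=; exists x; left.
    - by move/(att_inc tree) => bc; exists b; split=> //=; exists x; left.
    by move/(att_inc tree) => bc; exists b'; split=> //=; exists y; right.
  have bq : b != q c1.
    by apply/eqP => b_q; case: core_uv => uv_x; apply: (not_core x); rewrite -b_q -uv_x.
  by rewrite (descb b u) ?(descb b v).
have := connected_inP E_sym _ (conn h) _ invQ (inr c1) (inr c2).
by rewrite !inE c1h c2h => /(_ (eqxx _) (eqxx _)) /= <-; apply: desc_refl.
Qed.

Definition outside (h : H) : {set B * core} :=
  [set bx | full bx.1 & [exists c, (phi (inr c) == Some h) && att bx.1 bx.2.1 c]].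

(** At most [#|C|] neighbours contain a cut vertex. Any other is internal to a full block, whose
    core [h] does not meet, so it is reached from a cut vertex of [h]. *)
Lemma cut_degree c h : phi (inr c) = Some h -> degree h <= #|C| + #|outside h|.
Proof.
move=> ch; rewrite -[#|C|]cardsT.
pose X1 := [set h' | [exists c in [set: C], phi (inr c) == Some h']].
pose X2 := [set h' | [exists bx in outside h, phi (inl bx) == Some h']].
have le1 : #|X1| <= #|[set: C]| by apply: card_option_image.
have le2 : #|X2| <= #|outside h| by apply: card_option_image.
apply: leq_trans (leq_add le1 le2); apply: leq_trans (leq_card_setU _ _).
apply: subset_leq_card; apply/subsetP => h'; rewrite !inE => hh'.
have [[b int]|[c' c'h']] := internal_or_cut h'; last first.
  by apply/orP; left; apply/exists_inP; exists c'; rewrite ?inE ?c'h'.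
have full_b : full b by apply/existsP; exists h'.
have [u [v [uh vh' uv]]] := medge hh'.
have [y v_y] := internalP int vh'; rewrite v_y in vh' uv.
apply/orP; right; apply/exists_inP; exists (b, y); rewrite ?vh' // inE full_b /=.
case: u uh uv => [[b' x]|c'] uh /=.
  case/andP=> /eqP b'b _; rewrite b'b in uh.
  have [h1 + fib] := full_core int x; rewrite uh => -[hh1].
  by have := fib (inr c); rewrite -hh1 ch => /(_ erefl).
by move=> bc; apply/existsP; exists c'; rewrite uh eqxx.
Qed.

Lemma card_core_fst (P : pred L) : #|[set x : core | P x.1]| = #|[set l | P l]| * 2 ^ #|C|.
Proof.
have -> : [set x : core | P x.1] = setX [set l | P l] [set: {set C}].
  by apply/setP => -[l A]; rewrite !inE andbT.
by rewrite cardsX -powersetT card_powerset cardsT.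
Qed.

Lemma card_core : #|core| = #|L| * 2 ^ #|C|.
Proof. by rewrite -cardsT -[RHS](congr1 (muln^~ _) (cardsT L)) -card_core_fst. Qed.

Lemma card_not_block b :
  #|[set x : core | lam x.1 != b]| + #|[set l | lam l == b]| * 2 ^ #|C| = #|core|.
Proof.
rewrite -card_core_fst addnC -[RHS](cardsC [set x : core | lam x.1 == b]).
by congr (_ + _); apply: eq_card => x; rewrite !inE.
Qed.

(** Otherwise the cut vertices of [h] reach full blocks only below themselves, at coordinates that
    belong to those blocks; the coordinates of the root contribute nothing. *)
Lemma full_top c h : phi (inr c) = Some h ->
  exists2 c', phi (inr c') = Some h & full (q c').
Proof.
move=> ch; have [/existsP[c' /andP[/eqP c'h full_c']]|notfull] :=
  boolP [exists c', (phi (inr c') == Some h) && full (q c')]; first by exists c'.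
have hostE c' l : phi (inr c') == Some h -> full (host c' l) ->
    host c' l = lam l /\ p (lam l) = Some c'.
  rewrite /host => c'h; case: eqP => // _ full_c'; case/existsP: notfull.
  by exists c'; rewrite c'h.
have out_le : #|outside h| <= #|[set x : core | lam x.1 != b0]|.
  apply: leq_trans (leq_imset_card (fun x : core => (lam x.1, x)) _).
  apply: subset_leq_card; apply/subsetP => -[b x]; rewrite inE /= => /andP[full_b].
  case/existsP=> c' /andP[c'h /eqP b_host]; rewrite b_host in full_b *.
  have [-> lam_c'] := hostE _ _ c'h full_b.
  apply/imsetP; exists x => //; rewrite inE.
  by apply: contra_eq_neq lam_c' => ->; rewrite (p_root tree).
have := cut_degree ch; have := deg_H h; have := card_not_block b0.
(* The root has weight at least 2, and twice [2 ^ #|C|] exceeds [#|C| + 1]. *)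
have := ltn_expl #|C| (ltnSn 1); have := lam_dom b0.
by move: #|[set l | lam l == b0]| (2 ^ #|C|) => w N; nia.
Qed.

Lemma all_full b : full b.
Proof.
apply: contraT => nfull.
have [b' nfull' min_b'] : exists2 b', ~~ full b' & forall b1, ~~ full b1 -> ord b' <= ord b1.
  by case: (@arg_minnP _ b (fun b1 => ~~ full b1) ord nfull) => b'; exists b'.
have full_lt b1 : ord b1 < ord b' -> full b1.
  by move=> lt1; apply: contraT => /min_b'; lia.
(* If the root is not full, consider a full block of least depth. The cut vertex above it is
   present, and [full_top] with [cut_above] produces a full block still higher. *)
case def_p: (p b') => [c|]; last first.
  have [b1 full_b1] : exists b1, full b1.
    have [h _] := card_gt0P (vertex_nonempty H).
    have [[b1 int]|[c /full_top[c' _ full_c']]] := internal_or_cut h; last by exists (q c').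
    by exists b1; apply/existsP; exists h.
  have [b2 full_b2 min_b2] : exists2 b2, full b2 & forall b1, full b1 -> ord b2 <= ord b1.
    by case: (@arg_minnP _ b1 full ord full_b1) => b2; exists b2.
  case def_p2: (p b2) => [c|]; last first.
    move/eqP: def_p2 nfull'; move/eqP: def_p; rewrite !(root_top tree) => /eqP-> /eqP<-.
    by rewrite full_b2.
  have lt_q := ord_parent tree def_p2.
  have [h0 int] := fullP full_b2.
  have [h ch] := full_cut int (p_inc tree def_p2).
  have [c1 c1h full_c1] := full_top ch.
  have le1 := min_b2 _ full_c1.
  have [c_c1|cc1] := eqVneq c c1; first by rewrite c_c1 in lt_q; lia.
  by have := cut_above full_c1 c1h ch cc1; lia.
have full_q := full_lt _ (ord_parent tree def_p).
have [h0 int] := fullP full_q.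
have [h ch] := full_cut int (q_inc tree c).
(* Two cut vertices of [h] with full blocks above them would each lie strictly higher than the
   other. *)
have nfull_q c' : phi (inr c') = Some h -> c' != c -> ~~ full (q c').
  move=> c'h c'c; apply/negP => full_c'.
  have := cut_above full_q ch c'h c'c.
  by have := cut_above full_c' c'h ch; rewrite eq_sym c'c => /(_ isT); lia.
pose X1 := [set x : core | lam x.1 != b'].
(* [X1] covers the neighbours gained at [c], with none in [b']. For any other cut vertex of [h], the
   block above is not full, hence at least as deep as [b'], so its full blocks are strictly
   deeper. *)
pose X2 := [set x : core | ord b' < ord (lam x.1)].
have out_le : #|outside h| <= #|X1| + #|X2|.
  have le1 := leq_imset_card (fun x : core => (host c x.1, x)) (mem X1).
  have le2 := leq_imset_card (fun x : core => (lam x.1, x)) (mem X2).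
  apply: leq_trans (leq_add le1 le2); apply: leq_trans (leq_card_setU _ _).
  apply: subset_leq_card; apply/subsetP => -[b1 x]; rewrite inE /= => /andP[full_b1].
  case/existsP=> c' /andP[/eqP c'h /eqP b_host]; rewrite b_host {b_host b1} in full_b1 *.
  have [c'_c|c'c] := eqVneq c' c.
    rewrite c'_c in full_b1 *; apply/setUP; left; apply/imsetP; exists x; rewrite // inE.
    by apply: contraNneq nfull' => lam_b'; move: full_b1; rewrite /host lam_b' def_p eqxx.
  have nfull_c' := nfull_q _ c'h c'c.
  apply/setUP; right; apply/imsetP; exists x.
    rewrite inE; move: full_b1; rewrite /host; case: eqP => [lam_c' _|_]; last by rewrite (negPf nfull_c').
    exact: leq_ltn_trans (min_b' _ nfull_c') (ord_parent tree lam_c').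
  by move: full_b1; rewrite /host; case: eqP => // _; rewrite (negPf nfull_c').
(* By [lam_dom] the loss at [b'] exceeds the gain from deeper blocks by at least twice [2 ^ #|C|],
   which is more than [#|C| + 1]. *)
have := cut_degree ch; have := deg_H h; have := card_not_block b'.
have := ltn_expl #|C| (ltnSn 1); have := lam_dom b'.
move: out_le; rewrite /X1 /X2 (card_core_fst (fun l => ord b' < ord (lam l))).
by move: #|[set l | lam l == b']| #|[set l | ord b' < ord (lam l)]| (2 ^ #|C|) => w w' N; nia.
Qed.

(** * The model is an isomorphism *)

Lemma rigid_total u : exists h, phi u = Some h.
Proof.
case: u => [[b x]|c].
  by have [h0 int] := fullP (all_full b); have [h] := full_core int x; exists h.
by have [h0 int] := fullP (all_full (q c)); exact: (full_cut int (q_inc tree c)).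
Qed.

Lemma rigid_inj : injective phi.
Proof.
have inj_core b x u : phi (inl (b, x)) = phi u -> inl (b, x) = u.
  have [h0 int] := fullP (all_full b); have [h -> fib] := full_core int x.
  by move=> /esym/fib.
case=> [[b x]|c] [[b' y]|c'] uv; try exact: inj_core; first exact/esym/inj_core.
have [h ch] := rigid_total (inr c); have c'h : phi (inr c') = Some h by rewrite -uv.
have [-> //|cc'] := eqVneq c c'.
have := cut_above (all_full _) c'h ch cc'.
by have := cut_above (all_full _) ch c'h; rewrite eq_sym cc' => /(_ isT); lia.
Qed.

(** Every edge has an end in a core, where the degree is exactly the required minimum, so no edge
    there can be lost. *)
Lemma rigid_edge u v h h' : phi u = Some h -> phi v = Some h' -> E u v -> edge h h'.
Proof.
suff core_case b x w k k' : phi (inl (b, x)) = Some k -> phi w = Some k' ->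
    E (inl (b, x)) w -> edge k k'.
  case: u v => [[b x]|c] [[b' y]|c'] uh vh' uv //; try exact: core_case uh vh' uv.
  by rewrite edge_sym; apply: core_case vh' uh _; rewrite E_sym.
move=> xk wk' xw; apply: contraT => kk'.
have: degree k <= #|nbrs p q lam (inl (b, x)) :\ w|.
  apply: leq_trans (card_option_image _ phi); apply: subset_leq_card.
  apply/subsetP => j; rewrite !inE => kj.
  have [u1 [v1 [u1k v1j uv1]]] := medge kj; apply/exists_inP; exists v1; rewrite ?v1j // !inE.
  have <- : u1 = inl (b, x) by apply: rigid_inj; rewrite u1k.
  rewrite uv1 andbT; apply: contraNneq kk' => v1w.
  by move: v1j; rewrite v1w wk' => -[->].
have := cardsD1 w (nbrs p q lam (inl (b, x))); rewrite inE xw card_nbrs_core.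
by have := deg_H k; lia.
Qed.

End Rigidity.

(** * Minimality and the choice of weights *)

Lemma min_degree_le (G : sgraph) (x : G) : min_degree G <= degree x.
Proof.
rewrite /min_degree; elim: (index_enum _) (mem_index_enum x) => [//|y s IHs].
rewrite inE big_cons => /predU1P[->|/IHs]; [exact: geq_minl | exact/leq_trans/geq_minr].
Qed.

Lemma le_min_degree (G : sgraph) m :
  m <= #|G| -> (forall x : G, m <= degree x) -> m <= min_degree G.
Proof.
move=> mG m_deg; apply: (big_ind (fun d => m <= d)) => // a b ma mb.
by rewrite leq_min ma.
Qed.

Lemma fast_weights (B : finType) (ord : B -> nat) (K : nat) :
  exists w : B -> nat, forall b, \sum_(b1 | ord b < ord b1) w b1 + K <= w b.
Proof.
pose D := \max_b ord b; have leD b : ord b <= D by apply: leq_bigmax.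
(* Each deeper block is lighter by a factor of at least [#|B|.+1], and there are at most [#|B|] of
   them, which leaves room for [K]. *)
pose w b := K * #|B|.+1 ^ (D - ord b); exists w => b.
have [le_D|lt_D] := leqP D (ord b).
  rewrite big_pred0 => [|b1]; first by rewrite leq_pmulr // expn_gt0.
  by apply/negbTE; rewrite -leqNgt; apply: leq_trans le_D.
have [e def_e] : exists e, D - ord b = e.+1 by exists (D - ord b).-1; lia.
have le_w b1 : ord b < ord b1 -> w b1 <= K * #|B|.+1 ^ e.
  by move=> b_b1; rewrite leq_mul2l leq_pexp2l ?orbT //; lia.
have: \sum_(b1 | ord b < ord b1) w b1 <= #|B| * (K * #|B|.+1 ^ e).
  apply: (@leq_trans (\sum_(b1 | ord b < ord b1) (K * #|B|.+1 ^ e))); first exact: leq_sum.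
  rewrite sum_nat_const leq_mul2r.
  by rewrite max_card orbT.
rewrite /w def_e expnS; have : 0 < #|B|.+1 ^ e by rewrite expn_gt0.
by move: (_ ^ e) => X; nia.
Qed.

Section Minimality.
Variables (B C L : finType) (I : B -> C -> bool).
Variables (b0 : B) (p : B -> option C) (q : C -> B) (ord : B -> nat) (lam : L -> B).
Hypothesis tree : rooted_at I b0 p q ord.
Hypothesis lam_large : forall b, 2 * #|C| + 4 <= #|[set l | lam l == b]|.
Hypothesis lam_dom : forall b,
  #|[set l | ord b < ord (lam l)]| + 2 <= #|[set l | lam l == b]|.

Local Notation G := (tree_graph b0 p q lam_large).
Local Notation k := #|core C L|.-2.

(** A minor [H'] of [H] of too large minimum degree gives a rigid model in [G]. It factors through
    [H], so the model of [H] in [G] is already an isomorphism. *)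
Lemma tree_forbidden : forbiddenD k G.
Proof.
(* This keeps the truncated predecessors in [k] and in the degree bound exact. *)
have core_gt1 : 1 < #|core C L|.
  rewrite card_core; have := card_L b0 lam_large.
  by have := ltn_expl #|C| (ltnSn 1); nia.
split=> [/(_ G)|H [minor_HG not_iso] H' minor_H'H].
  have minGG : minor G G by apply: MinorIso; exists id => //; exists id.
  move/(_ minGG); apply/negP; rewrite -ltnNge.
  have degG (u : G) : #|core C L|.-1 <= degree u.
    case: u => [[b x]|c]; first by rewrite -(card_nbrs_core p q lam b x).
    by apply: leq_trans (card_nbrs_cut p q lam c); apply: leq_pred.
  have [u _] := card_gt0P (vertex_nonempty G).
  have : #|core C L|.-1 <= min_degree G.
    by apply: le_min_degree => //; apply: leq_trans (degG u) (max_card _).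
  lia.
rewrite leqNgt; apply/negP => lt_k; apply: not_iso.
have [phi mod_phi] := minor_model minor_HG.
have [psi mod_psi] := minor_model minor_H'H.
have mod_comp := model_comp (@edge_sym G) (@edge_sym H) mod_phi mod_psi.
have degH' (h : H') : #|core C L|.-1 <= degree h.
  by have := min_degree_le h; lia.
have total := rigid_total tree lam_large lam_dom mod_comp degH'.
have inj := rigid_inj tree lam_large lam_dom mod_comp degH'.
have edg := rigid_edge tree lam_large lam_dom mod_comp degH'.
have ex_phi u : exists v, phi u == Some v.
  by have [h /=] := total u; case: (phi u) => // v _; exists v.
pose f u : H := xchoose (ex_phi u).
have fE u : phi u = Some (f u) := eqP (xchooseP (ex_phi u)).
have f_inj : injective f.
  by move=> u v uv; apply: inj; rewrite /= !fE uv.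
have f_surj v : exists u, f u = v.
  by have [u] := model_surj mod_phi v; rewrite fE => -[<-]; exists u.
apply: rel_iso_sym; exists f; first exact: bij_of_inj_surj.
(* Edges of [H] come from [G] since the branch sets are singletons; edges of [G] survive in [H]
   because they survive even in [H']. *)
move=> u v; apply/idP/idP => [/(model_edge mod_phi)[u' [v' []]]|uv].
  by rewrite !fE => -[/f_inj->] [/f_inj->].
have [[h uh] [h' vh']] := (total u, total v).
have /(model_edge mod_psi)[a [a' [ah a'h' aa']]] := edg _ _ _ _ uh vh' uv.
have [[s fs] [t ft]] := (f_surj a, f_surj a').
have <- : s = u by apply: inj; rewrite uh /= fE /= fs.
have <- : t = v by apply: inj; rewrite vh' /= fE /= ft.
by rewrite fs ft.
Qed.

End Minimality.

Lemma realize_rooted (B C : finType) (I : B -> C -> bool) b0 p q ord :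
    rooted_at I b0 p q ord ->
  exists k (G : sgraph), [/\ forbiddenD k G, connected G &
    rel_iso (incidence_rel I) (@block_tree_edge G)].
Proof.
(* At most [2 * #|C|] coordinates are touched in a full block; the 4 further ones serve the
   connectivity of bodies, and [lam_dom] needs a surplus of 2. *)
move=> tree; have [w w_fast] := fast_weights ord (2 * #|C| + 4).
(* A disjoint union of intervals gives [lam] fibres of exactly the prescribed sizes. *)
pose L : finType := {b : B & 'I_(w b)}; pose lam (l : L) : B := tag l.
have card_lam (P : pred B) : #|[set l | P (lam l)]| = \sum_(b | P b) w b.
  rewrite -sum1dep_card /lam.
  under [RHS]eq_bigr => b _ do rewrite -[w b]card_ord -sum1_card.
  by rewrite sig_big_dep; apply: eq_bigl => l; rewrite andbT.
have card_lam1 b : #|[set l | lam l == b]| = w b.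
  by rewrite (card_lam (pred1 b)) big_pred1_eq.
have lam_large b : 2 * #|C| + 4 <= #|[set l | lam l == b]|.
  by rewrite card_lam1; apply: leq_trans (w_fast b); apply: leq_addl.
have lam_dom b : #|[set l | ord b < ord (lam l)]| + 2 <= #|[set l | lam l == b]|.
  rewrite card_lam1 (card_lam (fun b1 => ord b < ord b1)).
  by apply: leq_trans (w_fast b); rewrite leq_add2l; lia.
exists #|core C L|.-2, (tree_graph b0 p q lam_large); split.
- exact: (tree_forbidden tree lam_large lam_dom).
- exact: (tree_connected tree).
exact: (tree_block_tree tree).
Qed.

Theorem theorem1p3 (T : sgraph) (hT : exists G : sgraph, is_block_tree T G) :
  exists (k : nat) (G : sgraph), forbiddenD k G /\ is_block_tree T G.
Proof.
have [G0 [conG0 isoT]] := hT.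
have [x _] := card_gt0P (vertex_nonempty T).
have [h _ _] := isoT.
have [b0 [p [q [ord /realize_rooted[k [G [forbG conG isoG]]]]]]] :=
  block_tree_rooted conG0 (h x).
exists k, G; split=> //; split=> //; exact: rel_iso_trans isoT isoG.
Qed.
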